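(* For any integer $n \geq 1$, there are infinitely many (pairwise non-isomorphic) finite simple connected graphs $G$ with minimal valency $\delta(G) = n$ which have non-free linear embeddings; that is, for each such $G$ there exists a linear embedding $f: G \to \mathbb{R}^3$ such that $\pi_1(\mathbb{R}^3 - f(G))$ is not a free group.
   Context: A graph is simple if it has no loop edges and no multiple edges between any two vertices. $V(G)$ is the set of vertices of $G$; for a vertex $v$, $d(v)$ denotes its valency (the number of edges incident to $v$), and the minimal valency is $\delta(G) = \min\{d(v) \mid v \in V(G)\}$. A graph is regarded as a topological space (a 1-dimensional complex) when speaking of embeddings. An embedding $f: G \to \mathbb{R}^3$ is called linear if each edge of $G$ is sent to a line segment in $\mathbb{R}^3$. An embedding $f: G \to \mathbb{R}^3$ of a finite connected graph is called free if $\pi_1(\mathbb{R}^3 - f(G))$ is a free group, and non-free otherwise. *)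

(* Defs.v *)
From HB Require Import structures.
From mathcomp Require Import all_boot all_order all_algebra generic_quotient.
From mathcomp Require Import all_classical all_reals topology normedtype homotopy.
From mathcomp Require Import ring lra.

Set Implicit Arguments.
Unset Strict Implicit.
Unset Printing Implicit Defensive.

Import Order.TTheory GRing.Theory Num.Theory.
Import numFieldNormedType.Exports.

Record sgraph := SGraph {
  vertex :> finType;
  adj : rel vertex;
  adj_sym : symmetric adj;
  adj_irrefl : irreflexive adj
}.

Definition edges (G : sgraph) : {set {set G}} :=
  [set [set x; y]%SET | x in G, y in adj x]%SET.

Definition valency (G : sgraph) (v : G) : nat :=
  #|[set e in edges G | v \in e]%SET|.

Definition min_valency_is (G : sgraph) (n : nat) : Prop :=
  (exists v : G, valency v = n) /\ (forall v : G, n <= valency v).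

Definition graph_connected (G : sgraph) : Prop :=
  0 < #|G| /\ forall x y : G, connect (@adj G) x y.

Definition graph_iso (G H : sgraph) : Prop :=
  exists2 h : G -> H, bijective h & forall x y, adj (h x) (h y) = adj x y.

Local Open Scope classical_set_scope.
Local Open Scope ring_scope.
Local Open Scope quotient_scope.

(* The 1-dimensional complex of G in barycentric coordinates: the weights x v
   add up to 1 and are carried by a single vertex or by an edge. *)
Definition realization_set (R : realType) (G : sgraph) : set {ptws G -> R} :=
  [set x | [/\ forall v, 0 <= x v, \sum_v x v = 1 &
    (exists v : G, forall w, w != v -> x w = 0) \/
    (exists2 e, e \in edges G & forall w, w \notin e -> x w = 0)]].

Definition realization (R : realType) (G : sgraph) : topologicalType :=
  set_type (@realization_set R G).

Definition edge_cell (R : realType) (G : sgraph) (e : {set G}) :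
    set (realization R G) :=
  [set x | forall w, w \notin e -> (set_val x : {ptws G -> R}) w = 0].

(* Openness of f onto its image: every open set of X is a preimage. *)
Definition embedding (X Y : topologicalType) (f : X -> Y) : Prop :=
  [/\ continuous f, injective f &
    forall U : set X, open U -> exists2 V : set Y, open V & U = f @^-1` V].

Definition line_segment (R : realType) (n : nat) (a b : 'rV[R]_n) :
    set 'rV[R]_n :=
  [set (1 - t) *: a + t *: b | t in `[0, 1]].

Definition linear_embedding (R : realType) (G : sgraph)
    (f : realization R G -> 'rV[R]_3) : Prop :=
  embedding f /\
  forall e, e \in edges G ->
    exists a b, f @` edge_cell e = line_segment a b.

Definition unit_interval (R : realType) : Type :=
  set_type [set t : R | 0 <= t <= 1].

HB.instance Definition _ (R : realType) :=
  Topological.copy (unit_interval R) (set_type [set t : R | 0 <= t <= 1]).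

Lemma continuous_compose (X Y Z : topologicalType) (f : X -> Y) (g : Y -> Z) :
  continuous f -> continuous g -> continuous (fun x => g (f x)).
Proof.
by move=> cf cg x; apply: (@continuous_comp _ _ _ f g); [exact: cf|exact: cg].
Qed.

Lemma continuous_pair (X Y Z : topologicalType) (f : X -> Y) (g : X -> Z) :
  continuous f -> continuous g -> continuous (fun x => (f x, g x)).
Proof. by move=> cf cg x; apply: cvg_pair; [exact: cf|exact: cg]. Qed.

Lemma continuous_fst (X Y : topologicalType) : continuous (@fst X Y).
Proof. by move=> x; exact: cvg_fst. Qed.

Lemma continuous_snd (X Y : topologicalType) : continuous (@snd X Y).
Proof. by move=> x; exact: cvg_snd. Qed.

Section UnitInterval.
Context {R : realType}.
Notation I := (unit_interval R).

Definition ival (t : I) : R := set_val t.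

Lemma ival_bounds (t : I) : 0 <= ival t <= 1.
Proof. exact: (set_mem (valP t)). Qed.

Lemma ival_inj : injective ival.
Proof. by move=> s t; exact: val_inj. Qed.

Lemma ival_continuous : continuous ival.
Proof. exact: initial_continuous. Qed.

Lemma clamp_subproof (r : R) :
  Num.max 0 (Num.min 1 r) \in [set t : R | 0 <= t <= 1].
Proof. by rewrite inE /= le_max ge_max ge_min !lexx ler01. Qed.

Definition clamp (r : R) : I := SigSub (clamp_subproof r).

Lemma ival_clamp r : ival (clamp r) = Num.max 0 (Num.min 1 r).
Proof. by []. Qed.

Lemma clamp_ival t : clamp (ival t) = t.
Proof.
apply: ival_inj; rewrite ival_clamp; have /andP[t0 t1] := ival_bounds t.
by rewrite (min_idPr t1) (max_idPr t0).
Qed.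

Lemma clamp_ge1 r : 1 <= r -> clamp r = clamp 1.
Proof. by move=> r1; apply: ival_inj; rewrite !ival_clamp minxx (min_idPl r1). Qed.

Lemma clamp_le0 r : r <= 0 -> clamp r = clamp 0.
Proof.
move=> r0; apply: ival_inj; rewrite !ival_clamp.
by rewrite !(min_idPr _) ?(le_trans r0) ?ler01 // maxxx (max_idPl r0).
Qed.

Lemma clamp_continuous : continuous clamp.
Proof.
apply: continuous_comp_initial.
apply: max_fun_continuous; first exact: cst_continuous.
by apply: min_fun_continuous; [exact: cst_continuous|move=> x; exact: cvg_id].
Qed.

Lemma clamp01 : clamp 0 != clamp 1.
Proof.
apply/eqP => /(congr1 ival); rewrite !ival_clamp minxx !(min_idPr _) ?ler01 //.
by rewrite maxxx (max_idPr _) ?ler01 // => /eqP; rewrite eq_sym oner_eq0.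
Qed.

HB.instance Definition _ := isBiPointed.Build I clamp01.

Lemma ival0 : ival zero = 0.
Proof. by rewrite [zero]/(clamp 0) ival_clamp (min_idPr _) ?ler01 // maxxx. Qed.

Lemma ival1 : ival one = 1.
Proof. by rewrite [one]/(clamp 1) ival_clamp minxx (max_idPr _) ?ler01. Qed.

End UnitInterval.

Lemma pasting (R : realType) (X Y : topologicalType) (f g : Y -> X) (h : Y -> R)
    (c : R) :
  continuous f -> continuous g -> continuous h ->
  (forall y, h y = c -> f y = g y) ->
  continuous (fun y => if h y <= c then f y else g y).
Proof.
move=> cf cg ch fg y; have [hy|hy|hy] := ltgtP (h y) c.
- move=> U; rewrite /= (ltW hy) => fU.
  have hN : \forall z \near y, h z < c := ch y _ (lt_nbhsl hy).
  have fN : nbhs y (f @^-1` U) := cf y _ fU.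
  by apply: filterS (filterI hN fN) => z /= [/ltW hz fz]; rewrite hz.
- move=> U; rewrite /= leNgt hy /= => gU.
  have hN : \forall z \near y, c < h z := ch y _ (lt_nbhsr hy).
  have gN : nbhs y (g @^-1` U) := cg y _ gU.
  by apply: filterS (filterI hN gN) => z /= [hz gz]; rewrite leNgt hz.
- move=> U; rewrite /= hy lexx => fU.
  have gU : nbhs (g y) U by rewrite -fg.
  have fN : nbhs y (f @^-1` U) := cf y _ fU.
  have gN : nbhs y (g @^-1` U) := cg y _ gU.
  by apply: filterS (filterI fN gN) => z /= [fz gz]; case: ifP.
Qed.

Section FundamentalGroup.
Context {R : realType} {X : topologicalType} (x0 : X).
Notation I := (unit_interval R).

Definition loop := {path I from x0 to x0 in X}.

(* Homotopy relative to the end points; the second coordinate is the time. *)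
Definition homotopic (p q : loop) : Prop := exists H : I * I -> X,
  [/\ continuous H,
      forall t, H (t, zero) = p t,
      forall t, H (t, one) = q t,
      forall s, H (zero, s) = x0 &
      forall s, H (one, s) = x0].

Lemma loop_continuous (p : loop) : continuous p.
Proof. exact: cts_fun. Qed.

Lemma loop0 (p : loop) : p zero = x0.
Proof. exact: path_zero. Qed.

Lemma loop1 (p : loop) : p one = x0.
Proof. exact: path_one. Qed.

Lemma homotopic_refl p : homotopic p p.
Proof.
exists (fun z => p z.1); split => //=.
- exact: (continuous_compose (@continuous_fst _ _) (@loop_continuous p)).
- by move=> s; exact: loop0.
- by move=> s; exact: loop1.
Qed.

Lemma reparam_continuous (phi : R -> R) :
  continuous phi -> continuous (fun t : I => clamp (phi (ival t))).
Proof.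
move=> cphi.
apply: (@continuous_compose _ _ _ (fun t => phi (ival t)) clamp).
  exact: (continuous_compose ival_continuous cphi).
exact: clamp_continuous.
Qed.

Definition irev (t : I) : I := clamp (1 - ival t).

Lemma ival_irev t : ival (irev t) = 1 - ival t.
Proof.
rewrite ival_clamp; have /andP[t0 t1] := ival_bounds t.
by rewrite (min_idPr _) ?(max_idPr _) ?subr_ge0 // gerBl.
Qed.

Lemma irev0 : irev zero = one.
Proof. by apply: ival_inj; rewrite ival_irev ival0 ival1 subr0. Qed.

Lemma irev1 : irev one = zero.
Proof. by apply: ival_inj; rewrite ival_irev ival0 ival1 subrr. Qed.

Lemma irev_continuous : continuous irev.
Proof.
apply: (@reparam_continuous (fun t => 1 - t)) => t.
by apply: cvgB; [exact: cvg_cst|exact: cvg_id].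
Qed.

Lemma homotopic_sym p q : homotopic p q -> homotopic q p.
Proof.
case=> H [cH H0 H1 Hx Hy]; exists (fun z => H (z.1, irev z.2)); split => //=.
- apply: (@continuous_compose _ _ _ (fun z => (z.1, irev z.2)) H) => //.
  apply: continuous_pair; first exact: continuous_fst.
  exact: (continuous_compose (@continuous_snd _ _) irev_continuous).
- by move=> t; rewrite irev0.
- by move=> t; rewrite irev1.
Qed.

Definition ihalf1 (t : I) : I := clamp (2 * ival t).
Definition ihalf2 (t : I) : I := clamp (2 * ival t - 1).

Let mul2_continuous : continuous (fun t : R => 2 * t).
Proof. by move=> t; apply: cvgM; [exact: cvg_cst|exact: cvg_id]. Qed.

Let mul2B_continuous : continuous (fun t : R => 2 * t - 1).
Proof.
by move=> t; apply: cvgB; [exact: mul2_continuous|exact: cvg_cst].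
Qed.

Lemma ihalf1_continuous : continuous ihalf1.
Proof. exact: reparam_continuous mul2_continuous. Qed.

Lemma ihalf2_continuous : continuous ihalf2.
Proof. exact: reparam_continuous mul2B_continuous. Qed.

Lemma ihalf1_0 : ihalf1 zero = zero.
Proof. by rewrite /ihalf1 ival0 mulr0. Qed.

Lemma ihalf1_half t : ival t = 2^-1 -> ihalf1 t = one.
Proof. by move=> th; rewrite /ihalf1 th mulfV ?pnatr_eq0. Qed.

Lemma ihalf2_half t : ival t = 2^-1 -> ihalf2 t = zero.
Proof. by move=> th; rewrite /ihalf2 th mulfV ?pnatr_eq0// subrr. Qed.

Lemma ihalf2_1 : ihalf2 one = one.
Proof. by rewrite /ihalf2 ival1 mulr1 (_ : 2 - 1 = 1 :> R)//; ring. Qed.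

Let half_ge0 : (0 <= 2^-1 :> R) = true. Proof. by rewrite invr_ge0 ler0n. Qed.

Let half_lt1 : (1 <= 2^-1 :> R) = false.
Proof. by apply/negbTE; rewrite -ltNge invf_lt1 ?ltr1n. Qed.

Lemma homotopic_trans p q r : homotopic p q -> homotopic q r -> homotopic p r.
Proof.
case=> H [cH H0 H1 Hx Hy] [K [cK K0 K1 Kx Ky]].
exists (fun z => if ival z.2 <= 2^-1 then H (z.1, ihalf1 z.2)
                 else K (z.1, ihalf2 z.2)); split => /=.
- apply: (@pasting _ _ _ (fun z => H (z.1, ihalf1 z.2))
    (fun z => K (z.1, ihalf2 z.2)) (fun z => ival z.2)).
  + apply: (@continuous_compose _ _ _ (fun z => (z.1, ihalf1 z.2)) H) => //.
    apply: continuous_pair; first exact: continuous_fst.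
    exact: (continuous_compose (@continuous_snd _ _) ihalf1_continuous).
  + apply: (@continuous_compose _ _ _ (fun z => (z.1, ihalf2 z.2)) K) => //.
    apply: continuous_pair; first exact: continuous_fst.
    exact: (continuous_compose (@continuous_snd _ _) ihalf2_continuous).
  + exact: (continuous_compose (@continuous_snd _ _) ival_continuous).
  + by move=> z zh; rewrite ihalf1_half// ihalf2_half// H1 K0.
- by move=> t; rewrite ival0 half_ge0 ihalf1_0.
- by move=> t; rewrite ival1 half_lt1 ihalf2_1.
- by move=> s; case: ifP.
- by move=> s; case: ifP.
Qed.

Definition cst_loop : loop := @cst I X x0.

Definition rev_fun (p : loop) (t : I) : X := p (irev t).

Lemma rev_continuous p : continuous (rev_fun p).
Proof. exact: (continuous_compose irev_continuous (@loop_continuous p)). Qed.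

Lemma rev_zero p : rev_fun p zero = x0.
Proof. by rewrite /rev_fun irev0; exact: loop1. Qed.

Lemma rev_one p : rev_fun p one = x0.
Proof. by rewrite /rev_fun irev1; exact: loop0. Qed.

Definition rev_loop (p : loop) : loop :=
  mk_path (@rev_continuous p) (rev_zero p) (rev_one p).

Lemma rev_loopE p t : rev_loop p t = p (irev t).
Proof. by []. Qed.

Definition cat_fun (p q : loop) (t : I) : X :=
  if ival t <= 2^-1 then p (ihalf1 t) else q (ihalf2 t).

Lemma cat_continuous p q : continuous (cat_fun p q).
Proof.
apply: pasting.
- exact: (continuous_compose ihalf1_continuous (@loop_continuous p)).
- exact: (continuous_compose ihalf2_continuous (@loop_continuous q)).
- exact: ival_continuous.
- by move=> t th; rewrite ihalf1_half// ihalf2_half// loop0 loop1.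
Qed.

Lemma cat_zero p q : cat_fun p q zero = x0.
Proof. by rewrite /cat_fun ival0 half_ge0 ihalf1_0; exact: loop0. Qed.

Lemma cat_one p q : cat_fun p q one = x0.
Proof. by rewrite /cat_fun ival1 half_lt1 ihalf2_1; exact: loop1. Qed.

Definition cat_loop (p q : loop) : loop :=
  mk_path (@cat_continuous p q) (cat_zero p q) (cat_one p q).

Lemma cat_loopE p q t : cat_loop p q t =
  if ival t <= 2^-1 then p (clamp (2 * ival t)) else q (clamp (2 * ival t - 1)).
Proof. by []. Qed.

Lemma cat_homotopic p p' q q' :
  homotopic p p' -> homotopic q q' ->
  homotopic (cat_loop p q) (cat_loop p' q').
Proof.
case=> H [cH H0 H1 Hx Hy] [K [cK K0 K1 Kx Ky]].
exists (fun z => if ival z.1 <= 2^-1 then H (ihalf1 z.1, z.2)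
                 else K (ihalf2 z.1, z.2)); split => /=.
- apply: (@pasting _ _ _ (fun z => H (ihalf1 z.1, z.2))
    (fun z => K (ihalf2 z.1, z.2)) (fun z => ival z.1)).
  + apply: (@continuous_compose _ _ _ (fun z => (ihalf1 z.1, z.2)) H) => //.
    apply: continuous_pair; last exact: continuous_snd.
    exact: (continuous_compose (@continuous_fst _ _) ihalf1_continuous).
  + apply: (@continuous_compose _ _ _ (fun z => (ihalf2 z.1, z.2)) K) => //.
    apply: continuous_pair; last exact: continuous_snd.
    exact: (continuous_compose (@continuous_fst _ _) ihalf2_continuous).
  + exact: (continuous_compose (@continuous_fst _ _) ival_continuous).
  + by move=> z zh; rewrite ihalf1_half// ihalf2_half// Hy Kx.
- by move=> t; rewrite H0 K0.
- by move=> t; rewrite H1 K1.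
- by move=> s; rewrite ival0 half_ge0 ihalf1_0.
- by move=> s; rewrite ival1 half_lt1 ihalf2_1.
Qed.

Lemma rev_homotopic p q :
  homotopic p q -> homotopic (rev_loop p) (rev_loop q).
Proof.
case=> H [cH H0 H1 Hx Hy]; exists (fun z => H (irev z.1, z.2)); split => //=.
- apply: (@continuous_compose _ _ _ (fun z => (irev z.1, z.2)) H) => //.
  apply: continuous_pair; last exact: continuous_snd.
  exact: (continuous_compose (@continuous_fst _ _) irev_continuous).
- by move=> t; rewrite irev0.
- by move=> t; rewrite irev1.
Qed.

(* Two reparametrizations of the same loop with the same endpoints are
   homotopic, by the straight-line homotopy of the parameters. *)
Lemma reparam_homotopic (p q r : loop) (a b : R -> R) :
  continuous a -> continuous b ->
  (forall t, p t = r (clamp (a (ival t)))) ->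
  (forall t, q t = r (clamp (b (ival t)))) ->
  clamp (a 0) = clamp (b 0) -> clamp (a 1) = clamp (b 1) ->
  homotopic p q.
Proof.
move=> ca cb pE qE ab0 ab1.
pose c (z : R * R) : R := (1 - z.2) * ival (clamp (a z.1)) +
  z.2 * ival (clamp (b z.1)).
have cc : continuous c.
  have ci (f : R -> R) : continuous f ->
      continuous (fun z : R * R => ival (clamp (f z.1))).
    move=> cf; apply: (@continuous_compose _ _ _ (fun z => f z.1)
        (fun r => ival (clamp r))).
      exact: (continuous_compose (@continuous_fst _ _) cf).
    exact: (continuous_compose clamp_continuous ival_continuous).
  move=> z; apply: cvgD; apply: cvgM.
  - by apply: cvgB; [exact: cvg_cst|exact: continuous_snd].
  - exact: ci.
  - exact: continuous_snd.
  - exact: ci.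
pose h (z : I * I) : X := r (clamp (c (ival z.1, ival z.2))).
exists h; split.
- apply: (@continuous_compose _ _ _ (fun z : I * I => clamp (c (ival z.1, ival z.2))) r);
    last exact: loop_continuous.
  apply: (@continuous_compose _ _ _ (fun z : I * I => c (ival z.1, ival z.2)) clamp);
    last exact: clamp_continuous.
  apply: (@continuous_compose _ _ _ (fun z : I * I => (ival z.1, ival z.2)) c) => //.
  apply: continuous_pair.
    exact: (continuous_compose (@continuous_fst _ _) ival_continuous).
  exact: (continuous_compose (@continuous_snd _ _) ival_continuous).
- by move=> t; rewrite /h /c /= ival0 subr0 mul1r mul0r addr0 clamp_ival pE.
- by move=> t; rewrite /h /c /= ival1 subrr mul1r mul0r add0r clamp_ival qE.
- move=> s; rewrite /h /c /= ival0 ab0 -mulrDl subrK mul1r clamp_ival.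
  by rewrite -[X in b X]ival0 -qE; exact: loop0.
- move=> s; rewrite /h /c /= ival1 ab1 -mulrDl subrK mul1r clamp_ival.
  by rewrite -[X in b X]ival1 -qE; exact: loop1.
Qed.

Lemma cat_cst_l p : homotopic (cat_loop cst_loop p) p.
Proof.
apply: (@reparam_homotopic _ _ p (fun t => 2 * t - 1) id).
- exact: mul2B_continuous.
- by move=> t; exact: cvg_id.
- move=> t; rewrite cat_loopE; case: ifPn => // th.
  by rewrite [RHS](_ : _ = x0) // clamp_le0 ?(loop0 p) //; lra.
- by move=> t; rewrite clamp_ival.
- by rewrite clamp_le0//; lra.
- by congr clamp; ring.
Qed.

Lemma cat_cst_r p : homotopic (cat_loop p cst_loop) p.
Proof.
apply: (@reparam_homotopic _ _ p (fun t => 2 * t) id).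
- exact: mul2_continuous.
- by move=> t; exact: cvg_id.
- move=> t; rewrite cat_loopE; case: ifPn => //; rewrite -ltNge => th.
  by rewrite [RHS](_ : _ = x0) // clamp_ge1 ?(loop1 p) //; lra.
- by move=> t; rewrite clamp_ival.
- by rewrite mulr0.
- by rewrite clamp_ge1//; lra.
Qed.

Lemma cat_revl p : homotopic (cat_loop (rev_loop p) p) cst_loop.
Proof.
apply: (@reparam_homotopic _ _ p
  (fun t => Num.max (1 - 2 * t) (2 * t - 1)) (fun=> 1)).
- apply: max_fun_continuous; last exact: mul2B_continuous.
  by move=> t; apply: cvgB; [exact: cvg_cst|exact: mul2_continuous].
- exact: cst_continuous.
- move=> t; have /andP[t0 t1] := ival_bounds t.
  rewrite cat_loopE; case: ifPn => th.
    rewrite rev_loopE /irev ival_clamp [Num.min 1 _](min_idPr _) ?[Num.max 0 _](max_idPr _); [|lra..].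
    by rewrite (max_idPl _)//; lra.
  by rewrite (max_idPr _)//; lra.
- by move=> t; rewrite loop1.
- by rewrite mulr0 (max_idPl _) ?subr0//; lra.
- by rewrite (max_idPr _) /=; [congr clamp; ring|lra].
Qed.

Lemma cat_revr p : homotopic (cat_loop p (rev_loop p)) cst_loop.
Proof.
apply: (@reparam_homotopic _ _ p
  (fun t => Num.min (2 * t) (2 - 2 * t)) (fun=> 0)).
- apply: min_fun_continuous; first exact: mul2_continuous.
  by move=> t; apply: cvgB; [exact: cvg_cst|exact: mul2_continuous].
- exact: cst_continuous.
- move=> t; have /andP[t0 t1] := ival_bounds t.
  rewrite cat_loopE; case: ifPn => th.
    by rewrite (min_idPl _)//; lra.
  rewrite rev_loopE /irev ival_clamp [Num.min 1 _](min_idPr _) ?[Num.max 0 _](max_idPr _); [|lra..].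
  by rewrite (min_idPr _); [congr (p (clamp _)); ring|lra].
- by move=> t; rewrite loop0.
- by rewrite mulr0 (min_idPl _)//; lra.
- by rewrite (min_idPr _) /=; [congr clamp; ring|lra].
Qed.

Lemma cat_assoc p q r :
  homotopic (cat_loop p (cat_loop q r)) (cat_loop (cat_loop p q) r).
Proof.
apply: homotopic_sym; apply: (@reparam_homotopic _ _ (cat_loop p (cat_loop q r))
  (fun t => Num.min (2 * t) (Num.min (t + 4^-1) (2^-1 * t + 2^-1))) id).
- apply: min_fun_continuous; first exact: mul2_continuous.
  apply: min_fun_continuous => t; apply: cvgD;
    try (exact: cvg_cst || exact: cvg_id).
  by apply: cvgM; [exact: cvg_cst|exact: cvg_id].
- by move=> t; exact: cvg_id.
- move=> t; have /andP[t0 t1] := ival_bounds t.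
  rewrite [LHS]cat_loopE; case: ifPn => th.
    rewrite cat_loopE ival_clamp [Num.min 1 _](min_idPr _) ?[Num.max 0 _](max_idPr _); [|lra..].
    case: ifPn => th'.
      rewrite (min_idPl _) ?le_min; last lra.
      rewrite cat_loopE ival_clamp [Num.min 1 _](min_idPr _) ?[Num.max 0 _](max_idPr _); [|lra..].
      by rewrite th'.
    rewrite [X in Num.min _ X](min_idPl _) 1?(min_idPr _); [|lra..].
    rewrite cat_loopE ival_clamp [Num.min 1 _](min_idPr _) ?[Num.max 0 _](max_idPr _); [|lra..].
    case: ifPn => th''; first (exfalso; lra).
    rewrite cat_loopE ival_clamp [Num.min 1 _](min_idPr _) ?[Num.max 0 _](max_idPr _); [|lra..].
    by case: ifPn => th3; [congr (q (clamp _)); lra|exfalso; lra].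
  rewrite [X in Num.min _ X](min_idPr _) 1?(min_idPr _); [|lra..].
  rewrite cat_loopE ival_clamp [Num.min 1 _](min_idPr _) ?[Num.max 0 _](max_idPr _); [|lra..].
  case: ifPn => th''; first (exfalso; lra).
  rewrite cat_loopE ival_clamp [Num.min 1 _](min_idPr _) ?[Num.max 0 _](max_idPr _); [|lra..].
  by case: ifPn => th3; [exfalso; lra|congr (r (clamp _)); lra].
- by move=> t; rewrite clamp_ival.
- by rewrite mulr0 (min_idPl _)// le_min; lra.
- by rewrite (min_idPr _) 1?(min_idPr _)/=; [congr clamp; lra|lra..].
Qed.

Definition homotopicb (p q : loop) : bool := `[< homotopic p q >].

Lemma homotopicb_refl : reflexive homotopicb.
Proof. by move=> p; apply/asboolP; exact: homotopic_refl. Qed.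

Lemma homotopicb_sym : symmetric homotopicb.
Proof. by move=> p q; apply/asboolP/asboolP; exact: homotopic_sym. Qed.

Lemma homotopicb_trans : transitive homotopicb.
Proof.
by move=> q p r /asboolP pq /asboolP qr; apply/asboolP/(homotopic_trans pq qr).
Qed.

Canonical homotopic_equiv :=
  EquivRel homotopicb homotopicb_refl homotopicb_sym homotopicb_trans.

Definition fundamental_group : Type := {eq_quot homotopic_equiv}.

HB.instance Definition _ := Choice.on fundamental_group.
HB.instance Definition _ := Quotient.on fundamental_group.

Definition loop_class (p : loop) : fundamental_group :=
  \pi_(fundamental_group) p.

Lemma loop_classP p q : loop_class p = loop_class q <-> homotopic p q.
Proof. by split=> [/eqmodP/asboolP|pq]; [|apply/eqmodP/asboolP]. Qed.

Lemma loop_class_repr (a : fundamental_group) : loop_class (repr a) = a.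
Proof. exact: reprK. Qed.

Lemma loop_class_ind (P : fundamental_group -> Prop) :
  (forall p, P (loop_class p)) -> forall a, P a.
Proof. by move=> Pp a; rewrite -(loop_class_repr a). Qed.

Definition pi1_one : fundamental_group := loop_class cst_loop.

Definition pi1_mul (a b : fundamental_group) : fundamental_group :=
  loop_class (cat_loop (repr a) (repr b)).

Definition pi1_inv (a : fundamental_group) : fundamental_group :=
  loop_class (rev_loop (repr a)).

Lemma pi1_mulE p q :
  pi1_mul (loop_class p) (loop_class q) = loop_class (cat_loop p q).
Proof.
by apply/loop_classP/cat_homotopic; apply/loop_classP; exact: loop_class_repr.
Qed.

Lemma pi1_invE p : pi1_inv (loop_class p) = loop_class (rev_loop p).
Proof.
by apply/loop_classP/rev_homotopic; apply/loop_classP; exact: loop_class_repr.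
Qed.

Lemma pi1_mulA : associative pi1_mul.
Proof.
elim/loop_class_ind => p; elim/loop_class_ind => q; elim/loop_class_ind => r.
by rewrite !pi1_mulE; apply/loop_classP/cat_assoc.
Qed.

Lemma pi1_mul1g : left_id pi1_one pi1_mul.
Proof.
by elim/loop_class_ind => p; rewrite pi1_mulE; apply/loop_classP/cat_cst_l.
Qed.

Lemma pi1_mulg1 : right_id pi1_one pi1_mul.
Proof.
by elim/loop_class_ind => p; rewrite pi1_mulE; apply/loop_classP/cat_cst_r.
Qed.

Lemma pi1_mulVg : left_inverse pi1_one pi1_inv pi1_mul.
Proof.
elim/loop_class_ind => p; rewrite pi1_invE pi1_mulE.
exact/loop_classP/cat_revl.
Qed.

Lemma pi1_mulgV : right_inverse pi1_one pi1_inv pi1_mul.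
Proof.
elim/loop_class_ind => p; rewrite pi1_invE pi1_mulE.
exact/loop_classP/cat_revr.
Qed.

HB.instance Definition _ := isGroup.Build fundamental_group
  pi1_mulA pi1_mul1g pi1_mulg1 pi1_mulVg pi1_mulgV.

End FundamentalGroup.
Arguments fundamental_group R {X} x0.

(* Freeness by the universal property of a basis B. *)
Definition free_group (F : groupType) : Prop :=
  exists B : set F, forall (G : groupType) (f : B -> G),
    exists! phi : {multiplicative F -> G}, forall b : B, phi (set_val b) = f b.

(* The complement of an embedded graph is path-connected, so the base point is
   immaterial. *)
Definition free_embedding (R : realType) (G : sgraph)
    (f : realization R G -> 'rV[R]_3) : Prop :=
  forall x0 : set_type (~` range f), free_group (fundamental_group R x0).

(* Main.v *)
Require Import Defs.
From HB Require Import structures.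
From mathcomp Require Import all_boot all_order all_algebra.
From mathcomp Require Import all_classical all_reals topology normedtype homotopy.
From mathcomp Require Import ring lra zify.

(* The graphs consist of a trefoil with 20 axis-parallel sticks (a grid diagram
   of size 5), with a small cluster of vertices on a moment curve attached at
   each corner; the clusters raise the valencies and make the graphs pairwise
   non-isomorphic.

   Free groups are projective, so a homomorphism from a free group to the
   dihedral group of Z/3 lifts to the infinite dihedral group.  The complement
   of the graph has meridians g0, ..., g4, one for each column of the diagram,
   which satisfy Neuwirth's relations: the product of the meridians met by a
   horizontal plane between two rows is trivial.  The 3-colouring of the trefoil
   sends them to reflections that are not all equal, but in the infinite
   dihedral group reflections with these relations must coincide, because
   integer colourings of the trefoil are constant.

   The colouring becomes a homomorphism through the holonomy of a locally
   defined cocycle, given by the cells that the grid planes cut out of space and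
   by the curtains hanging from the knot.  The relations hold by homotopies of
   polygonal loops with even integer vertices, whereas the knot has odd
   coordinates; that every cell of such a homotopy avoids the knot, and also the
   clusters, is a finite computation with integers. *)

Set Implicit Arguments.
Unset Strict Implicit.
Unset Printing Implicit Defensive.

Import Order.TTheory GRing.Theory Num.Theory.
Import numFieldNormedType.Exports.

Local Open Scope classical_set_scope.
Local Open Scope ring_scope.

(** * Free groups and dihedral groups *)

(** Projectivity of free groups: the basis is sent to chosen preimages under [q], and uniqueness in
    the universal property identifies [q \o phi] with [rho]. *)
Lemma free_group_lift (F G H : groupType) (q : {multiplicative H -> G})
    (rho : {multiplicative F -> G}) :
  free_group F -> (forall g, exists h, q h = g) ->
  exists phi : {multiplicative F -> H}, forall x, q (phi x) = rho x.
Proof.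
case=> B Bfree q_surj.
have /choice[s sK] : forall g, exists h, q h = g by [].
have [phi [phiE _]] := Bfree H (fun b => s (rho (set_val b))).
exists phi => x.
have [psi [_ psi_uniq]] := Bfree G (fun b => rho (set_val b)).
have psi_rho : psi = rho by apply: psi_uniq.
have psi_phi : psi = q \o phi :> {multiplicative F -> G}.
  by apply: psi_uniq => b /=; rewrite phiE sK.
by rewrite -psi_rho psi_phi.
Qed.

(* The generalized dihedral group: [(a, s)] is the map x |-> a +- x, a
   reflection when [s] is true. *)
Definition dih (A : zmodType) : Type := (A * bool)%type.

Section Dihedral.
Variable A : zmodType.

HB.instance Definition _ := Choice.on (dih A).

Definition dih_mul (x y : dih A) : dih A :=
  (x.1 + (if x.2 then - y.1 else y.1), x.2 (+) y.2).

Definition dih_one : dih A := (0, false).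

Definition dih_inv (x : dih A) : dih A :=
  (if x.2 then x.1 else - x.1, x.2).

Lemma dih_mulA : associative dih_mul.
Proof.
move=> [a []] [b []] [c []]; rewrite /dih_mul /=; congr (_, _);
  by rewrite ?opprD ?opprK ?addrA.
Qed.

Lemma dih_mul1 : left_id dih_one dih_mul.
Proof. by move=> [a []]; rewrite /dih_mul /= add0r. Qed.

Lemma dih_mul1r : right_id dih_one dih_mul.
Proof. by move=> [a []]; rewrite /dih_mul /= ?oppr0 addr0. Qed.

Lemma dih_mulV : left_inverse dih_one dih_inv dih_mul.
Proof. by move=> [a []]; rewrite /dih_mul /dih_one /= ?subrr ?addNr. Qed.

Lemma dih_mulVr : right_inverse dih_one dih_inv dih_mul.
Proof. by move=> [a []]; rewrite /dih_mul /dih_one /= ?subrr. Qed.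

HB.instance Definition _ := isGroup.Build (dih A)
  dih_mulA dih_mul1 dih_mul1r dih_mulV dih_mulVr.

Lemma dih_mulE (x y : dih A) : (x * y)%g = dih_mul x y.
Proof. by []. Qed.

Lemma dih_oneE : 1%g = dih_one.
Proof. by []. Qed.

Definition reflection (a : A) : dih A := (a, true).

End Dihedral.

Definition dih_map (A B : zmodType) (f : {additive A -> B}) (x : dih A) : dih B :=
  (f x.1, x.2).

Lemma dih_map_mul (A B : zmodType) (f : {additive A -> B}) :
  {morph dih_map f : x y / (x * y)%g}.
Proof.
by move=> [a []] [b []]; rewrite /dih_map !dih_mulE /dih_mul /= ?raddfB ?raddfD.
Qed.

HB.instance Definition _ (A B : zmodType) (f : {additive A -> B}) :=
  isMultiplicative.Build (dih A) (dih B) (dih_map f) (dih_map_mul f).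

Definition mod3 (a : int) : 'Z_3 := a%:~R.

HB.instance Definition _ := GRing.Additive.copy mod3 (fun a : int => a%:~R : 'Z_3).

Lemma trefoil_not_free (F : groupType) (g0 g1 g2 g3 g4 : F)
    (rho : {multiplicative F -> dih 'Z_3}) :
  (g0 * g3 = 1)%g -> ((g0 * g1) * (g3 * g4) = 1)%g ->
  ((g1 * g2) * (g3 * g4) = 1)%g -> (g2 * g4 = 1)%g ->
  rho g0 = reflection 0 -> rho g1 = reflection 1 -> rho g2 = reflection 2%:R ->
  rho g3 = reflection 0 -> rho g4 = reflection 2%:R -> ~ free_group F.
Proof.
move=> r1 r2 r3 r4 rho0 rho1 rho2 rho3 rho4 Ffree.
have [x|phi phiE] := @free_group_lift _ _ _ (dih_map mod3) rho Ffree.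
  exists ((x.1 : nat)%:Z, x.2); case: x => a s; congr (_, _) => /=.
  by rewrite /mod3 -pmulrn natr_Zp.
have lift x a : rho x = reflection a ->
    exists2 b : int, phi x = (b, true) & b%:~R = a :> 'Z_3.
  by rewrite -phiE /dih_map; case: (phi x) => b s [<- ->]; exists b.
have [b0 h0 e0] := lift _ _ rho0; have [b1 h1 e1] := lift _ _ rho1.
have [b2 h2 _] := lift _ _ rho2; have [b3 h3 _] := lift _ _ rho3.
have [b4 h4 _] := lift _ _ rho4.
have phi1 : phi 1%g = 1%g by apply: (@mulgI _ (phi 1%g)); rewrite -gmulfM !mulg1.
move: (congr1 phi r1) (congr1 phi r2) (congr1 phi r3) (congr1 phi r4).
rewrite !gmulfM phi1 h0 h1 h2 h3 h4 !dih_mulE /dih_mul dih_oneE /dih_one /=.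
move=> [E1] [E2] [E3] [E4].
(* The translation parts give b0 = b3, b2 = b4, b0 + b3 = b1 + b4 and b1 + b3 = b2 + b4, whence 3
   (b0 - b2) = 0. Over the integers this forces b0 = b1; mod 3 it leaves room for the
   3-colouring. *)
have b01 : b0 = b1 by lia.
by move: e1; rewrite -b01 e0.
Qed.

(** * Holonomy of local cocycles *)

(** Connectedness of the interval: the set where [f] equals [f a] is relatively open and relatively
    closed in [a, b]. *)
Lemma locally_constant_segment (R : realType) (T : Type) (f : R -> T) (a b : R) :
  a <= b ->
  (forall t, a <= t <= b -> exists2 U, nbhs t U &
    forall u, U u -> a <= u <= b -> f u = f t) -> f b = f a.
Proof.
move=> ab f_loc; pose B := [set u | a <= u <= b /\ f u = f a].
have BE : B = `[a, b]%classic.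
  apply: (@segment_connected R a b B).
  - by exists a; rewrite /B /= lexx ab.
  - exists (interior [set u | a <= u <= b -> f u = f a]); first exact: open_interior.
    apply/seteqP; split=> u /=; rewrite in_itv /=; last first.
      by case=> abu /interior_subset/(_ abu).
    case=> abu fu; split=> //; have [U Uu Uf] := f_loc _ abu.
    by apply: filterS Uu => v Uv abv; rewrite Uf.
  - exists (~` (interior [set u | a <= u <= b -> f u <> f a])).
      by apply/open_closedC/open_interior.
    apply/seteqP; split=> u /=; rewrite in_itv /=.
      by case=> abu fu; split=> // /interior_subset/(_ abu).
    case=> abu fu; split=> //; apply: contrapT => fua; apply: fu.
    have [U Uu Uf] := f_loc _ abu.
    by apply: filterS Uu => v Uv abv; rewrite Uf.
have : B b by rewrite BE /= in_itv /= ab lexx.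
by case.
Qed.

Section Transport.
Context {R : realType} {X : topologicalType} {G : groupType}.
Variable tau : X -> X -> G.
Local Open Scope group_scope.

(** [tau p q] plays the role of parallel transport from p to q, composed from left to right. It is
    total on pairs of points, but trusted only on sets where this identity holds. *)
Definition cocycle_on (A : set X) :=
  forall p q r, A p -> A q -> A r -> tau p q * tau q r = tau p r.

Lemma cocycle_on1 (A : set X) p : cocycle_on A -> A p -> tau p p = 1.
Proof. by move=> cA Ap; apply: (@mulgI _ (tau p p)); rewrite cA// mulg1. Qed.

Definition cocycle_near (x : X) := exists2 U, nbhs x U & cocycle_on U.

(** [s] is a lift of the curve [c] to the principal covering with fibre [G] that [tau] defines. *)
Definition transport_lift (c : R -> X) (a b : R) (s : R -> G) :=
  forall t, (a <= t <= b)%R -> exists2 U, nbhs t U &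
    forall u v, U u -> U v -> (a <= u <= b)%R -> (a <= v <= b)%R ->
      s u * tau (c u) (c v) = s v.

(** The quotient [s u * (s' u)^-1] of two lifts is locally constant. *)
Lemma transport_lift_uniq c a b s s' : (a <= b)%R ->
  transport_lift c a b s -> transport_lift c a b s' -> s a = s' a -> s b = s' b.
Proof.
move=> ab sL s'L sa; pose f u := s u * (s' u)^-1.
have : s b * (s' b)^-1 = s a * (s' a)^-1.
  apply: (@locally_constant_segment _ _ f) => //; move=> t abt.
  have [U Ut Us] := sL t abt; have [U' U't U's] := s'L t abt.
  exists (U `&` U'); first exact: filterI.
  have Ut' := nbhs_singleton Ut; have U't' := nbhs_singleton U't.
  by move=> u [Uu U'u] abu; rewrite /f -(Us t u)// -(U's t u)// invgM mulgA mulgK.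
by rewrite sa mulgV => /divg1_eq.
Qed.

Lemma transport_lift_sub c a b a' b' s : (a <= a')%R -> (b' <= b)%R ->
  transport_lift c a b s -> transport_lift c a' b' s.
Proof.
move=> aa' bb' sL; have sub u : (a' <= u <= b' -> a <= u <= b)%R.
  by case/andP=> au ub; rewrite (le_trans aa')//= (le_trans ub).
move=> t /sub /sL[U Ut Us]; exists U => // u v Uu Uv /sub abu /sub abv.
exact: Us.
Qed.

Lemma transport_lift_eq c c' a b s s' :
  (forall t, (a <= t <= b)%R -> c t = c' t) ->
  (forall t, (a <= t <= b)%R -> s t = s' t) ->
  transport_lift c a b s -> transport_lift c' a b s'.
Proof.
move=> cc' ss' sL t /sL[U Ut Us]; exists U => // u v Uu Uv abu abv.
by rewrite -!ss'// -!cc'//; exact: Us.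
Qed.

Lemma transport_lift_mul g c a b s :
  transport_lift c a b s -> transport_lift c a b (fun t => g * s t).
Proof.
move=> sL t /sL[U Ut Us]; exists U => // u v Uu Uv abu abv.
by rewrite -mulgA Us.
Qed.

Lemma transport_lift_comp (phi : R -> R) c a b a' b' s : continuous phi ->
  (forall t, a <= t <= b -> a' <= phi t <= b')%R ->
  transport_lift c a' b' s ->
  transport_lift (fun t => c (phi t)) a b (fun t => s (phi t)).
Proof.
move=> cphi phiab sL t /phiab/sL[U Ut Us].
exists (phi @^-1` U); first exact: cphi.
by move=> u v Uu Uv /phiab abu /phiab abv; exact: Us.
Qed.

Lemma transport_lift_cocycle c a b (A : set X) : cocycle_on A ->
  (forall t, (a <= t <= b)%R -> A (c t)) ->
  transport_lift c a b (fun t => tau (c a) (c t)).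
Proof.
move=> cA Ac t abt; exists setT; first exact: filterT.
move=> u v _ _ abu abv; apply: cA; apply: Ac => //.
by rewrite lexx; case/andP: abt; exact: le_trans.
Qed.

Lemma cocycle_near1 x : cocycle_near x -> tau x x = 1.
Proof.
by case=> U Ux cU; apply: cocycle_on1 cU _; exact: nbhs_singleton.
Qed.

Lemma transport_lift_cat c a b d s s' : cocycle_near (c b) ->
  continuous c -> (a <= b <= d)%R ->
  transport_lift c a b s -> transport_lift c b d s' -> s b = s' b ->
  transport_lift c a d (fun t => if (t <= b)%R then s t else s' t).
Proof.
move=> [N Nb cN] cc /andP[ab bd] sL s'L ss' t /andP[at_ td].
have [tb|bt|->] := ltgtP t b.
- have [|U Ut Us] := sL t; first by rewrite at_ ltW.
  exists (U `&` [set u | (u < b)%R]).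
    by apply: filterI => //; exact: lt_nbhsl.
  move=> u v [Uu /ltW ub] [Uv /ltW vb] /andP[au _] /andP[av _].
  by rewrite ub vb Us// ?au ?av.
- have [|U Ut Us] := s'L t; first by rewrite td ltW.
  exists (U `&` [set u | (b < u)%R]).
    by apply: filterI => //; exact: lt_nbhsr.
  move=> u v [Uu bu] [Uv bv] /andP[_ ud] /andP[_ vd].
  by rewrite !leNgt bu bv /= Us// ?ud ?vd ?ltW.
- have [|U Ub Us] := sL b; first by rewrite ab lexx.
  have [|U' U'b U's] := s'L b; first by rewrite bd lexx.
  exists ((U `&` U') `&` (c @^-1` N)).
    by apply: filterI; [exact: filterI|exact: cc].
  have Ub' := nbhs_singleton Ub; have U'b' := nbhs_singleton U'b.
  (* Around the junction both halves are expressed by transport from [c b], so that the cocycle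
     identity also compares parameters on opposite sides of [b]. *)
  have key u : (U `&` U') u -> (a <= u <= d)%R ->
      (if (u <= b)%R then s u else s' u) = s b * tau (c b) (c u).
    move=> [Uu U'u] /andP[au ud]; have [ub|bu] := leP u b.
      by rewrite Us// ?lexx ?ab ?au ?ub.
    by rewrite ss' U's// ?lexx ?bd ?ud ?ltW.
  move=> u v [Uu Nu] [Uv Nv] adu adv; rewrite !key// -mulgA cN//.
  exact: nbhs_singleton Nb.
Qed.

Hypothesis tau_cocycle : forall x, cocycle_near x.

Let tau1 x : tau x x = 1 := cocycle_near1 (tau_cocycle x).

(** Continuous induction: the truth of having a lift up to t is locally constant in t, because
    inside a ball that [c] maps into a cocycle neighbourhood a lift is prolonged by transport from
    its last value. *)
Lemma transport_lift_exists c a b : continuous c -> (a <= b)%R ->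
  exists2 s, transport_lift c a b s & s a = 1.
Proof.
move=> cc ab; pose Q t := exists2 s, transport_lift c a t s & s a = 1.
have Qa : Q a.
  exists (fun=> 1) => // t /le_anti <-; exists setT; first exact: filterT.
  by move=> u v _ _ /le_anti <- /le_anti <-; rewrite tau1 mulg1.
suff : `[<Q b>] = `[<Q a>] by move=> QE; apply/asboolP; rewrite QE; apply/asboolP.
apply: (@locally_constant_segment _ _ (fun t => `[<Q t>])) => // t abt.
have [N Nt cN] := tau_cocycle (c t).
have /nbhs_ballP[e /= e0 eN] : nbhs t (c @^-1` N) by exact: cc.
exists (ball t e); first exact: nbhsx_ballx.
have step x y : ball t e x -> ball t e y -> (a <= x)%R -> (x <= y)%R -> Q x -> Q y.
  move=> xe ye ax xy [s sL sa].
  have sL' : transport_lift c x y (fun u => s x * tau (c x) (c u)).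
    apply: transport_lift_mul; apply: transport_lift_cocycle cN _ => u /andP[xu uy].
    apply: eN; move: xe ye; rewrite /ball /= !ltr_norml.
    by move=> /andP[? ?] /andP[? ?]; apply/andP; split; lra.
  eexists; first apply: (transport_lift_cat (tau_cocycle _) cc _ sL sL').
  - by rewrite ax xy.
  - by rewrite tau1 mulg1.
  - by rewrite /= ax.
have back x y : (x <= y)%R -> Q y -> Q x.
  by move=> xy [s sL sa]; exists s => //; exact: transport_lift_sub sL.
move=> u Uu /andP[au ub]; case/andP: abt => at_ tb.
have tt : ball t e t by exact: ballxx.
apply/idP/idP => /asboolP q; apply/asboolP; have [ut|tu] := lerP u t.
- exact: step q.
- exact: back (ltW tu) q.
- exact: back ut q.
- by apply: step q => //; exact: ltW.
Qed.

Definition transports (c : R -> X) (g : G) :=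
  exists s, [/\ transport_lift c 0%R 1%R s, s 0%R = 1 & s 1%R = g].

Lemma transports_uniq c g h : transports c g -> transports c h -> g = h.
Proof.
move=> [s [sL s0 <-]] [s' [s'L s'0 <-]].
by apply: (transport_lift_uniq _ sL s'L); rewrite ?s0 ?s'0 ?ler01.
Qed.

Lemma transports_exists c : continuous c -> exists g, transports c g.
Proof.
move=> cc; have [s sL s0] := transport_lift_exists cc (@ler01 R).
by exists (s 1%R), s.
Qed.

(** The transport at time s is locally constant in s. By compactness of [0, 1], for s near s0 the
    curves at times s0 and s lie, locally in t, in common cocycle sets. The lift at s0 multiplied by
    the rungs [tau (H (t, s0)) (H (t, s))] is then a lift at s, and the rungs at the fixed end
    points are trivial. *)
Lemma transports_homotopy (H : R * R -> X) (x0 x1 : X) g :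
  continuous H -> (forall s, H (0%R, s) = x0) -> (forall s, H (1%R, s) = x1) ->
  transports (fun t => H (t, 0%R)) g -> transports (fun t => H (t, 1%R)) g.
Proof.
move=> cH H0 H1 g0.
have cHs s : continuous (fun t => H (t, s)).
  apply: (@continuous_compose _ _ _ (fun t => (t, s)) H) => //.
  by apply: continuous_pair => t; [exact: cvg_id|exact: cvg_cst].
have /choice[T TE] : forall s, exists g, transports (fun t => H (t, s)) g.
  by move=> s; exact: transports_exists.
suff T01 : T 1%R = T 0%R by rewrite -(transports_uniq (TE 0%R) g0) -T01.
apply: locally_constant_segment => // s0 _.
pose P (s t : R) := exists2 U, nbhs t U & cocycle_on
  [set x | exists2 u, U u & x = H (u, s0) \/ x = H (u, s)].
have near_P : \forall s \near s0, `[0%R, 1%R]%classic `<=` P s.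
  have /compact_near_coveringP := @segment_compact R 0%R 1%R.
  move/(_ _ (nbhs s0) P); apply => t _.
  have [N Nt cN] := tau_cocycle (H (t, s0)).
  have [[V W] /= [Vt Ws] VWN] : nbhs (t, s0) (H @^-1` N) by exact: cH.
  exists (interior V, W); first by split=> //; exact: nbhs_interior.
  move=> [t' s] /= [Vt' Ws']; exists V => //.
  have sub x : (exists2 u, V u & x = H (u, s0) \/ x = H (u, s)) -> N x.
    move=> [u Vu [->|->]]; apply: (VWN (u, _)) => //; split=> //=.
    exact: nbhs_singleton Ws.
  by move=> p q r /sub Np /sub Nq /sub Nr; exact: cN.
exists [set s | `[0%R, 1%R]%classic `<=` P s] => // s sP _.
have [f [fL f0 f1]] := TE s0.
apply: transports_uniq (TE s) _.
exists (fun t => f t * tau (H (t, s0)) (H (t, s))); split.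
- move=> t t01; have [U Ut Uf] := fL _ t01; have [V Vt cV] := sP _ t01.
  exists (U `&` V); first exact: filterI.
  move=> u v [Uu Vu] [Uv Vv] u01 v01; rewrite -(Uf u v)//.
  by rewrite -!mulgA !cV //; (exists u + exists v) => //; tauto.
- by rewrite !H0 tau1 mulg1.
- by rewrite !H1 tau1 mulg1.
Qed.

Lemma transports_cat (c c1 c2 : R -> X) g1 g2 :
  continuous c -> (forall t, (0 <= t <= 2^-1)%R -> c t = c1 (2 * t)%R) ->
  (forall t, (2^-1 <= t <= 1)%R -> c t = c2 (2 * t - 1)%R) ->
  transports c1 g1 -> transports c2 g2 -> transports c (g1 * g2).
Proof.
move=> cc cc1 cc2 [s1 [L1 s10 s11]] [s2 [L2 s20 s21]].
have c_dbl : continuous (fun t : R => 2 * t)%R.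
  by move=> t; apply: cvgM; [exact: cvg_cst|exact: cvg_id].
have L1' : transport_lift c 0%R (2^-1)%R (fun t => s1 (2 * t)%R).
  have D1 : forall t : R, (0 <= t <= 2^-1 -> 0 <= 2 * t <= 1)%R.
    by move=> t /andP[? ?]; apply/andP; split; lra.
  apply: transport_lift_eq (transport_lift_comp c_dbl D1 L1) => // t t01.
  by rewrite cc1.
have L2' : transport_lift c (2^-1)%R 1%R (fun t => g1 * s2 (2 * t - 1)%R).
  have D2 : forall t : R, (2^-1 <= t <= 1 -> 0 <= 2 * t - 1 <= 1)%R.
    by move=> t /andP[? ?]; apply/andP; split; lra.
  have c_dbl1 : continuous (fun t : R => 2 * t - 1)%R.
    by move=> t; apply: cvgB; [exact: c_dbl|exact: cvg_cst].
  apply: transport_lift_mul.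
  apply: transport_lift_eq (transport_lift_comp c_dbl1 D2 L2) => // t t01.
  by rewrite cc2.
have h01 : (0 <= (2^-1 : R) <= 1)%R by apply/andP; split; lra.
eexists; split; first apply: (transport_lift_cat (tau_cocycle _) cc h01 L1' L2').
- by rewrite mulfV ?pnatr_eq0// subrr s11 s20 mulg1.
- by rewrite /= ifT ?mulr0//; lra.
- rewrite /= ifF; last by apply/negbTE; rewrite -ltNge; lra.
  by rewrite (_ : 2 * 1 - 1 = 1)%R ?s21//; ring.
Qed.

Variable x0 : X.
Notation pi1 := (fundamental_group R x0).

Definition loop_curve (p : @loop R X x0) (t : R) : X := p (clamp t).

Lemma loop_curve_continuous p : continuous (loop_curve p).
Proof. exact: (continuous_compose clamp_continuous (@loop_continuous _ _ _ p)). Qed.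

Lemma transports_homotopic p q g : homotopic p q ->
  transports (loop_curve p) g -> transports (loop_curve q) g.
Proof.
move=> [H [cH Hp Hq H0 H1]] pg.
pose K (z : R * R) := H (clamp z.1, clamp z.2).
have cK : continuous K.
  apply: (@continuous_compose _ _ _ (fun z : R * R => (clamp z.1, clamp z.2)) H) => //.
  apply: continuous_pair.
    exact: (continuous_compose (@continuous_fst _ _) clamp_continuous).
  exact: (continuous_compose (@continuous_snd _ _) clamp_continuous).
have -> : loop_curve q = fun t => K (t, 1%R).
  by apply/funext => t; rewrite /K /= Hq.
apply: (transports_homotopy cK (x0 := x0) (x1 := x0)).
- by move=> s; exact: H0.
- by move=> s; exact: H1.
- suff -> : (fun t => K (t, 0%R)) = loop_curve p by [].
  by apply/funext => t; rewrite /K /= Hp.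
Qed.

(** The default 1 is never taken, by [transports_exists], and the value is unique by
    [transports_uniq]. *)
Definition holonomy (a : pi1) : G := xget 1 (transports (loop_curve (repr a))).

Lemma holonomyE p g : transports (loop_curve p) g -> holonomy (loop_class p) = g.
Proof.
move=> pg; rewrite /holonomy; case: xgetP => [h _ hP|/(_ g)].
  apply: transports_uniq hP _; apply: transports_homotopic pg.
  by apply: homotopic_sym; apply/loop_classP; rewrite loop_class_repr.
case; apply: transports_homotopic pg.
by apply: homotopic_sym; apply/loop_classP; rewrite loop_class_repr.
Qed.

Lemma holonomyM : {morph holonomy : a b / a * b}.
Proof.
elim/(@loop_class_ind R) => p; elim/(@loop_class_ind R) => q.
have [g pg] := transports_exists (@loop_curve_continuous p).
have [h qh] := transports_exists (@loop_curve_continuous q).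
rewrite (holonomyE pg) (holonomyE qh) [X in holonomy X]pi1_mulE.
apply/holonomyE/transports_cat; [| | |exact: pg|exact: qh].
- exact: loop_curve_continuous.
- move=> t /andP[t0 t1]; rewrite /loop_curve cat_loopE.
  by rewrite ival_clamp (min_idPr _) ?(max_idPr _) ?t1//; lra.
- move=> t /andP[t0 t1]; rewrite /loop_curve cat_loopE.
  rewrite ival_clamp (min_idPr _) ?(max_idPr _) //; last lra.
  case: ifPn => // th; have -> : t = (2^-1)%R by lra.
  rewrite mulfV ?pnatr_eq0// subrr.
  by rewrite [LHS]loop1 [RHS]loop0.
Qed.

Definition holonomy_hom : {multiplicative pi1 -> G} :=
  HB.pack holonomy (isMultiplicative.Build pi1 G holonomy holonomyM).

End Transport.

(** * Polygonal loops *)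

Section Polyline.
Context {R : realType} {V : normedModType R}.
Implicit Types (a : V) (w : seq V) (u : R).

Fixpoint polyline a w u : V :=
  if w is b :: w' then
    if u <= 1 then (1 - u) *: a + u *: b else polyline b w' (u - 1)
  else a.

Lemma polyline0 a w : polyline a w 0 = a.
Proof. by case: w => //= b w; rewrite ler01 subr0 scale1r scale0r addr0. Qed.

Lemma polyline_continuous a w : continuous (polyline a w).
Proof.
elim: w a => [|b w IHw] a /=; first exact: cst_continuous.
apply: (@pasting R _ _ (fun u : R => (1 - u) *: a + u *: b)
  (fun u => polyline b w (u - 1)) id).
- move=> u; apply: cvgD; apply: cvgZr_tmp; last exact: cvg_id.
  by apply: cvgB; [exact: cvg_cst|exact: cvg_id].
- apply: continuous_compose (IHw b) => u.
  by apply: cvgB; [exact: cvg_id|exact: cvg_cst].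
- by move=> u; exact: cvg_id.
- by move=> u ->; rewrite subrr scale0r add0r scale1r polyline0.
Qed.

Lemma polyline_cat a w1 w2 u : 0 <= u ->
  polyline a (w1 ++ w2) u =
  if u <= (size w1)%:R then polyline a w1 u
  else polyline (last a w1) w2 (u - (size w1)%:R).
Proof.
elim: w1 a u => [|b w1 IHw] a u u0 /=.
  rewrite subr0; case: ifPn => // u0'; have -> : u = 0 by lra.
  exact: polyline0.
case: (lerP u 1) => u1.
  by rewrite ifT// (le_trans u1)// ler1n.
rewrite IHw; last lra.
by rewrite lerBlDr natr1; case: ifP => // _; congr polyline; rewrite -natr1; ring.
Qed.

Lemma polyline_last a w u : 0 <= u -> u = (size w)%:R -> polyline a w u = last a w.
Proof.
elim: w a u => [|b w IHw] a u //= u0 ->.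
case: lerP => w1; last by apply: IHw; rewrite -natr1; lra || ring.
have -> : w = [::] by case: w w1 {IHw u0} => //= c w; rewrite lern1.
by rewrite /= subrr scale0r add0r scale1r.
Qed.

End Polyline.

(** * Polygonal homotopies, cell by cell *)

Section Strip.
Context {R : realType} {V : normedModType R}.
Variable S : set V.
Implicit Types (a b : V) (w : seq V).

(** The ruled quadrilateral swept out when the edge from a to b moves linearly to the edge from a'
    to b'. *)
Definition strip_cell a b a' b' := forall u s : R, 0 <= u <= 1 -> 0 <= s <= 1 ->
  S ((1 - s) *: ((1 - u) *: a + u *: b) + s *: ((1 - u) *: a' + u *: b')).

Fixpoint strip a w a' w' : Prop :=
  match w, w' with
  | b :: w1, b' :: w1' => strip_cell a b a' b' /\ strip b w1 b' w1'
  | [::], [::] => True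
  | _, _ => False
  end.

Lemma strip_polyline a w a' w' (u s : R) : strip a w a' w' -> w <> [::] ->
  0 <= u <= (size w)%:R -> 0 <= s <= 1 ->
  S ((1 - s) *: polyline a w u + s *: polyline a' w' u).
Proof.
move=> + + + s01; elim: w a a' w' u => [//|b w IHw] a a' [//|b' w'] u /=.
move=> [cell str] _ /andP[u0 uw]; case: lerP => u1; first by apply: cell; rewrite ?u0.
apply: IHw => //; last by rewrite lerBlDr natr1 uw subr_ge0 ltW.
by move=> w0; move: uw; rewrite w0 /= leNgt u1.
Qed.

End Strip.

Local Notation coord p c := (nth 0%N p c).

Definition vpt (R : realType) (p : seq nat) : 'rV[R]_3 := \row_c (coord p c)%:R.

Definition separated (ps : seq (seq nat)) (e : seq nat * seq nat) : bool :=
  has (fun c =>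
    all (fun p => (coord p c < coord e.1 c)%N && (coord p c < coord e.2 c)%N) ps ||
    all (fun p => (coord e.1 c < coord p c)%N && (coord e.2 c < coord p c)%N) ps)
    (iota 0 3).

(* Half-open boxes: room for the clusters attached to the vertices. *)
Definition thick (R : realType) (e : seq nat * seq nat) : set 'rV[R]_3 :=
  [set v | forall c : 'I_3, (minn (coord e.1 c) (coord e.2 c))%:R <= v 0 c
    < (maxn (coord e.1 c) (coord e.2 c)).+1%:R].

Lemma convex_le (R : realType) (x y M u : R) : 0 <= u <= 1 ->
  x <= M -> y <= M -> (1 - u) * x + u * y <= M.
Proof. by move=> /andP[u0 u1] xM yM; nra. Qed.

Lemma convex_ge (R : realType) (x y M u : R) : 0 <= u <= 1 ->
  M <= x -> M <= y -> M <= (1 - u) * x + u * y.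
Proof. by move=> /andP[u0 u1] xM yM; nra. Qed.

(** In the separating coordinate the integer corners lie at least 1 below the minimum or at least 1
    above the maximum of the stick. By convexity so does the whole cell, which therefore misses the
    half-open box. *)
Lemma separated_thick (R : realType) a b a' b' e : separated [:: a; b; a'; b'] e ->
  strip_cell (~` @thick R e) (vpt R a) (vpt R b) (vpt R a') (vpt R b').
Proof.
case/hasP => c; rewrite mem_iota => /= c3 sep u s u01 s01 /(_ (Ordinal c3)).
rewrite !mxE /= => /andP[lo hi]; case/orP: sep; rewrite andbT.
- case/and4P => /andP[a1 a2] /andP[b1 b2] /andP[a'1 a'2] /andP[b'1 b'2].
  set m := minn _ _ in lo.
  suff : (m.-1)%:R >= m%:R :> R.
    by rewrite ler_nat /m; have := leq_ltn_trans (leq0n _) a1;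
       have := leq_ltn_trans (leq0n _) a2; lia.
  by apply: le_trans lo _; do !apply: convex_le => //; rewrite ler_nat /m; lia.
- case/and4P => /andP[a1 a2] /andP[b1 b2] /andP[a'1 a'2] /andP[b'1 b'2].
  move: hi; rewrite ltNge => /negP; apply.
  by do !apply: convex_ge => //; rewrite ler_nat; lia.
Qed.

Fixpoint free_strip (E : seq (seq nat * seq nat)) a w a' w' : bool :=
  match w, w' with
  | b :: w1, b' :: w1' =>
      all (separated [:: a; b; a'; b']) E && free_strip E b w1 b' w1'
  | [::], [::] => true
  | _, _ => false
  end.

Lemma free_strip_cons E a b w a' b' w' : free_strip E a (b :: w) a' (b' :: w') =
  all (separated [:: a; b; a'; b']) E && free_strip E b w b' w'.
Proof. by []. Qed.

Lemma free_strip_size E a w a' w' : free_strip E a w a' w' -> size w = size w'.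
Proof.
by elim: w a a' w' => [|b w IHw] a a' [|b' w'] //= /andP[_ /IHw ->].
Qed.

Lemma free_strip_thick (R : realType) E a w a' w' : free_strip E a w a' w' ->
  strip [set v | forall e, e \in E -> ~ @thick R e v]
    (vpt R a) (map (vpt R) w) (vpt R a') (map (vpt R) w').
Proof.
elim: w a a' w' => [|b w IHw] a a' [|b' w'] //= /andP[/allP sep /IHw str].
by split=> // u s u01 s01 e /sep; move/(@separated_thick R); apply.
Qed.

(** * Loops through lattice points *)

Section WordLoop.
Context {R : realType} (E : seq (seq nat * seq nat)) {D : set 'rV[R]_3}.
Hypothesis DE : forall v, (forall e, e \in E -> ~ @thick R e v) -> D v.
Variables (o : seq nat) (x0 : set_type D).
Hypothesis x0E : set_val x0 = vpt R o.
Implicit Types w : seq (seq nat).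

(** A word lists the vertices after the base point [o]. The degenerate strip from [w] to itself
    expresses that the loop misses every thick box. *)
Definition closed_word w := [&& w != [::], last o w == o & free_strip E o w o w].

Definition word_curve w (t : R) : 'rV[R]_3 :=
  polyline (vpt R o) (map (vpt R) w) ((size w)%:R * t).

Lemma word_curve_continuous w : continuous (word_curve w).
Proof.
apply: continuous_compose (@polyline_continuous _ _ _ _) => t.
by apply: cvgM; [exact: cvg_cst|exact: cvg_id].
Qed.

Lemma word_curve0 w : word_curve w 0 = vpt R o.
Proof. by rewrite /word_curve mulr0 polyline0. Qed.

Lemma word_curve1 w : closed_word w -> word_curve w 1 = vpt R o.
Proof.
case/and3P => _ /eqP wo _; rewrite /word_curve mulr1 polyline_last ?size_map//.
by rewrite last_map wo.
Qed.

Lemma strip_word_curve w w' t s : w != [::] -> free_strip E o w o w' ->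
  0 <= t <= 1 -> 0 <= s <= 1 ->
  D ((1 - s) *: word_curve w t + s *: word_curve w' t).
Proof.
move=> w0 str /andP[t0 t1] s01; apply: DE; rewrite /word_curve -(free_strip_size str).
apply: (strip_polyline (free_strip_thick R str)) => //.
  by case: w w0 {str}.
by rewrite size_map mulr_ge0//= ler_piMr.
Qed.

Lemma word_curve_in w : closed_word w -> forall t, 0 <= t <= 1 -> D (word_curve w t).
Proof.
case/and3P => w0 _ str t t01; have := strip_word_curve w0 str t01 (s := 0).
by rewrite subr0 scale1r scale0r addr0; apply; rewrite lexx ler01.
Qed.

Definition word_fun w (cw : closed_word w) (t : unit_interval R) : set_type D :=
  SigSub (mem_set (word_curve_in cw (ival_bounds t))).

Lemma word_fun_continuous w (cw : closed_word w) : continuous (word_fun cw).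
Proof.
apply: continuous_comp_initial.
exact: (continuous_compose ival_continuous (@word_curve_continuous w)).
Qed.

Lemma word_fun0 w (cw : closed_word w) : word_fun cw zero = x0.
Proof. by apply: val_inj; rewrite /= ival0 word_curve0 -x0E. Qed.

Lemma word_fun1 w (cw : closed_word w) : word_fun cw one = x0.
Proof. by apply: val_inj; rewrite /= ival1 word_curve1// -x0E. Qed.

Definition word_loop w (cw : closed_word w) : @loop R _ x0 :=
  mk_path (@word_fun_continuous w cw) (word_fun0 cw) (word_fun1 cw).

Lemma word_loopE w (cw : closed_word w) t :
  set_val (word_loop cw t) = word_curve w (ival t).
Proof. by []. Qed.

Lemma eq_homotopic (p q : @loop R (set_type D) x0) :
  (forall t, p t = q t) -> homotopic p q.
Proof.
move=> pq; have [H [cH H0 H1 Hx Hy]] := homotopic_refl p.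
by exists H; split=> // t; rewrite -pq.
Qed.

Lemma eq_word_loop w w' (cw : closed_word w) (cw' : closed_word w') :
  w = w' -> homotopic (word_loop cw) (word_loop cw').
Proof. by move=> ww'; apply: eq_homotopic => t; apply: val_inj; rewrite /= ww'. Qed.

Lemma word_loop_homotopic w w' (cw : closed_word w) (cw' : closed_word w') :
  free_strip E o w o w' -> homotopic (word_loop cw) (word_loop cw').
Proof.
move=> str; have w0 : w != [::] by case/and3P: cw.
pose h (z : unit_interval R * unit_interval R) :=
  (1 - ival z.2) *: word_curve w (ival z.1) + ival z.2 *: word_curve w' (ival z.1).
have hD z : h z \in D.
  by rewrite inE; apply: strip_word_curve => //; exact: ival_bounds.
exists (fun z => SigSub (hD z)); split.
- apply: continuous_comp_initial => z.
  have c1 : continuous (fun z : unit_interval R * unit_interval R => ival z.1).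
    exact: (continuous_compose (@continuous_fst _ _) ival_continuous).
  have c2 : continuous (fun z : unit_interval R * unit_interval R => ival z.2).
    exact: (continuous_compose (@continuous_snd _ _) ival_continuous).
  apply: cvgD; apply: cvgZ.
  + by apply: cvgB; [exact: cvg_cst|exact: c2].
  + exact: (continuous_compose c1 (@word_curve_continuous w)).
  + exact: c2.
  + exact: (continuous_compose c1 (@word_curve_continuous w')).
- by move=> t; apply: val_inj; rewrite /= /h /= ival0 subr0 scale1r scale0r addr0.
- by move=> t; apply: val_inj; rewrite /= /h /= ival1 subrr scale1r scale0r add0r.
- move=> s; apply: val_inj; rewrite /= /h /= ival0 !word_curve0.
  by rewrite -scalerDl subrK scale1r -x0E.
- move=> s; apply: val_inj; rewrite /= /h /= ival1 !word_curve1//.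
  by rewrite -scalerDl subrK scale1r -x0E.
Qed.

(** Concatenation of loops switches at parameter 1/2, the polygon after [size w] edges; for words of
    equal size the two parametrizations agree pointwise. *)
Lemma word_loop_cat w w' (cw : closed_word w) (cw' : closed_word w')
    (cww' : closed_word (w ++ w')) : size w = size w' ->
  loop_class (word_loop cww') = pi1_mul (loop_class (word_loop cw)) (loop_class (word_loop cw')).
Proof.
move=> ww'; rewrite pi1_mulE; apply/loop_classP/eq_homotopic => t.
have /andP[t0 t1] := ival_bounds t; have wo : last o w = o by case/and3P: cw => _ /eqP.
have w0 : (0 < (size w)%:R :> R).
  by rewrite ltr0n; case/and3P: cw; case: (w).
apply: val_inj; rewrite cat_loopE /= /word_curve map_cat polyline_cat; last first.
  by rewrite mulr_ge0.
rewrite size_map size_cat -ww' natrD.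
have -> : (((size w)%:R + (size w)%:R) * ival t <= (size w)%:R) = (ival t <= 2^-1).
  by apply/idP/idP => h; nra.
case: ifPn => th.
  rewrite /word_fun /= /word_curve ival_clamp (min_idPr _) ?(max_idPr _); [|lra..].
  by congr polyline; ring.
rewrite /word_fun /= /word_curve ival_clamp (min_idPr _) ?(max_idPr _); [|lra..].
by rewrite last_map wo -ww'; congr polyline; ring.
Qed.

Lemma path_word_loop_homotopic w rows (cw : closed_word w)
    (cl : closed_word (last w rows)) :
  all closed_word rows -> path (fun w w' => free_strip E o w o w') w rows ->
  homotopic (word_loop cw) (word_loop cl).
Proof.
elim: rows w cw cl => [|w' rows IHrows] w cw /= cl.
  by move=> _ _; apply: eq_homotopic => t; exact: val_inj.
case/andP => cw' crows /andP[str pth].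
exact: homotopic_trans (word_loop_homotopic cw cw' str) (IHrows _ cw' cl crows pth).
Qed.

Lemma polyline_nseq n (v : 'rV[R]_3) u : polyline v (nseq n v) u = v.
Proof.
by elim: n u => //= n IHn u; case: ifP => // _; rewrite -scalerDl subrK scale1r.
Qed.

Lemma word_loop_nseq n (cw : closed_word (nseq n o)) :
  homotopic (word_loop cw) (cst_loop x0).
Proof.
apply: eq_homotopic => t; apply: val_inj.
by rewrite /= /word_curve map_nseq polyline_nseq -x0E.
Qed.

(** The rows form a discrete homotopy that ends in a constant word of the same length. *)
Lemma word_loop_trivial w rows n (cw : closed_word w) :
  all closed_word (rcons rows (nseq n o)) ->
  path (fun w w' => free_strip E o w o w') w (rcons rows (nseq n o)) ->
  loop_class (word_loop cw) = pi1_one x0.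
Proof.
move=> crows pth; apply/loop_classP.
have cl : closed_word (nseq n o) by move: crows; rewrite all_rcons => /andP[].
have cl' : closed_word (last w (rcons rows (nseq n o))) by rewrite last_rcons.
apply: homotopic_trans (path_word_loop_homotopic cw cl' crows pth) _.
move: cl'; rewrite last_rcons => cl'; exact: word_loop_nseq.
Qed.

End WordLoop.

(** * The trefoil *)

(** Index of the slab that contains y, the walls being 1, 3, ..., 2n - 1; a point on a wall belongs
    to the slab above it. *)
Definition wall_count (R : realType) (n : nat) (y : R) : nat :=
  (\sum_(k < n) ((2 * k + 1)%:R <= y)%R)%N.

Lemma wall_count_le (R : realType) n (y : R) : (wall_count n y <= n)%N.
Proof.
rewrite /wall_count -[X in (_ <= X)%N]card_ord -sum1_card.
by apply: leq_sum => k _; exact: leq_b1.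
Qed.

Lemma ltn_wall_count (R : realType) k n (y : R) : (k < n)%N ->
  (k < wall_count n y)%N = ((2 * k + 1)%:R <= y).
Proof.
elim: n k => // n IHn k; rewrite ltnS /wall_count big_ord_recr /= -/(wall_count n y).
have [yn|yn] /= := leP (2 * n + 1)%:R y => kn.
  have -> : wall_count n y = n.
    apply/eqP; rewrite eqn_leq wall_count_le /=.
    case: n IHn yn {kn} => // n IHn yn; rewrite IHn//.
    by apply: le_trans yn; rewrite ler_nat; lia.
  rewrite addn1 ltnS kn; apply/esym.
  by apply: le_trans yn; rewrite ler_nat; lia.
rewrite addn0; move: kn; rewrite leq_eqVlt => /orP[/eqP ->|/IHn//].
by rewrite ltnNge wall_count_le leNgt yn.
Qed.

Lemma wall_count_nat (R : realType) n p : wall_count n (p%:R : R) = minn n (uphalf p).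
Proof.
have lt k : (k < n)%N -> (k < wall_count n (p%:R : R))%N = (2 * k + 1 <= p)%N.
  by move=> kn; rewrite ltn_wall_count// ler_nat.
have := wall_count_le n (p%:R : R); set q := wall_count _ _ in lt * => qn.
have lb : (q < n)%N -> (p < 2 * q + 1)%N by move/lt; rewrite ltnn; lia.
have ub : (0 < q)%N -> (2 * q.-1 + 1 <= p)%N by case: q lt qn {lb} => // q lt qn _; rewrite -lt.
have := uphalfE p; lia.
Qed.

Lemma wall_count_mono (R : realType) n : {homo @wall_count R n : x y / x <= y >-> (x <= y)%N}.
Proof.
move=> x y xy; apply: leq_sum => k _.
by case: leP => // kx; rewrite (le_trans kx).
Qed.

(** The case d = 1 is that of a point on the wall between the slabs [lo] and [lo + 1], the case d =
    0 that of an interior point of the slab [lo]. The guards on [lo] account for the two unbounded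
    outer slabs. *)
Lemma wall_count_near (R : realType) n (x : R) : exists lo d : nat,
  [/\ (d <= 1)%N, (lo + d <= n)%N,
      if d == 1%N then x = (2 * lo + 1)%:R else
        ((0 < lo)%N -> (2 * lo - 1)%:R < x) /\ ((lo < n)%N -> x < (2 * lo + 1)%:R) &
      \forall y \near x, (lo <= wall_count n y <= lo + d)%N].
Proof.
have hn := wall_count_le n x; set h := wall_count n x in hn.
have ub : (h < n)%N -> x < (2 * h + 1)%:R.
  by move=> h_lt; rewrite ltNge -(ltn_wall_count _ h_lt) ltnn.
have lb : (0 < h)%N -> (2 * h - 1)%:R <= x.
  move=> h0; have -> : (2 * h - 1 = 2 * h.-1 + 1)%N by lia.
  by rewrite -(@ltn_wall_count _ _ n)//; lia.
have near_ub : \forall y \near x, (wall_count n y <= h)%N.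
  move: hn; rewrite leq_eqVlt => /orP[/eqP ->|hn].
    by apply: filterS (@filterT _ (nbhs x) _) => y _; exact: wall_count_le.
  have := lt_nbhsl (ub hn); apply: filterS => y yh.
  by rewrite leqNgt ltn_wall_count// -ltNge.
have [/andP[h0 /eqP xh]|xh] := boolP ((0 < h)%N && (x == (2 * h - 1)%:R)).
  exists h.-1, 1%N; split => //; first lia.
    by rewrite xh; congr _%:R; lia.
  have near_lb : \forall y \near x, (2 * h - 1)%:R - 1 < y.
    by apply: lt_nbhsr; rewrite xh; lra.
  apply: filterS (filterI near_ub near_lb) => y /= [yh hy].
  rewrite addn1 prednK// yh andbT; case: (h) h0 xh hn yh hy => // -[//|k] _ _ hn _ hy.
  rewrite -pred_Sn ltn_wall_count//; last lia.
  move: hy; rewrite (_ : (2 * k.+2 - 1 = 2 * k + 1 + 2)%N); last lia.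
  by rewrite natrD; lra.
exists h, 0%N; split; rewrite ?addn0 => //=.
  by split=> // h0; rewrite lt_neqAle lb// andbT eq_sym; move: xh; rewrite h0.
case: (posnP h) => [h0|h0]; first by apply: filterS near_ub => y; rewrite h0.
have near_lb : \forall y \near x, (2 * h - 1)%:R < y.
  by apply: lt_nbhsr; rewrite lt_neqAle lb// andbT eq_sym; move: xh; rewrite h0.
apply: filterS (filterI near_ub near_lb) => y /= [yh hy].
rewrite yh andbT; case: (h) h0 hn hy => // k _ hn hy.
rewrite ltn_wall_count//; apply: ltW; apply: le_lt_trans hy.
by rewrite ler_nat; lia.
Qed.

(** Column i is the stick in x = 2i + 1 at height z = 3, row j the stick in y = 2j + 1 at height z =
    1, and vertical sticks join them at the corners; seen from above, columns cross over rows. *)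
Definition knot : seq (seq nat) :=
  [:: [:: 1; 1; 3]; [:: 1; 5; 3]; [:: 1; 5; 1]; [:: 5; 5; 1];
      [:: 5; 5; 3]; [:: 5; 9; 3]; [:: 5; 9; 1]; [:: 9; 9; 1];
      [:: 9; 9; 3]; [:: 9; 3; 3]; [:: 9; 3; 1]; [:: 3; 3; 1];
      [:: 3; 3; 3]; [:: 3; 7; 3]; [:: 3; 7; 1]; [:: 7; 7; 1];
      [:: 7; 7; 3]; [:: 7; 1; 3]; [:: 7; 1; 1]; [:: 1; 1; 1]]%N.

Definition knot_edges : seq (seq nat * seq nat) := zip knot (rot 1 knot).

Definition walls : seq nat := [:: 5; 5; 2]%N.

(* Cells are cut out by the planes x, y = 1, 3, 5, 7, 9 and z = 1, 3.  The
   curtain below column i (below row j) separates cells with z-index at most 1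
   (equal to 0). *)
Definition column_span : seq (nat * nat) :=
  [:: (0, 2); (1, 3); (2, 4); (0, 3); (1, 4)]%N.

Definition column_color : seq nat := [:: 0; 1; 2; 0; 2]%N.

(** Indexed by the row and the x-index of the cell. Where a row passes under a column of colour c,
    its colour r becomes 2c - r mod 3; at the corners it is the colour of the column. This is a Fox
    3-colouring. *)
Definition row_color : seq (seq (option nat)) :=
  [:: [:: None; Some 0; Some 0; Some 0; None; None];
      [:: None; None; Some 1; Some 1; Some 2; None];
      [:: None; Some 0; Some 2; None; None; None];
      [:: None; None; Some 1; Some 0; None; None];
      [:: None; None; None; Some 2; Some 2; None]]%N.

(** Reflections are involutions, so crossing a curtain in either direction contributes the same
    factor. *)
Definition color_reflection (o : option nat) : dih 'Z_3 :=
  if o is Some k then reflection (inZp k) else 1%g.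

Definition column_curtain (i y z : nat) : option nat :=
  let: (lo, hi) := nth (0, 0)%N column_span i in
  if (z <= 1)%N && (lo < y <= hi)%N then Some (nth 0%N column_color i) else None.

Definition row_curtain (j x z : nat) : option nat :=
  if z == 0%N then nth None (nth [::] row_color j) x else None.

(* Holonomy from cell p to cell q along a path moving first in direction x,
   then y, then z. *)
Definition cell_holonomy (p q : seq nat) : dih 'Z_3 :=
  (color_reflection (if coord p 0 == coord q 0 then None else
     column_curtain (maxn (coord p 0) (coord q 0)).-1 (coord p 1) (coord p 2)) *
   color_reflection (if coord p 1 == coord q 1 then None else
     row_curtain (maxn (coord p 1) (coord q 1)).-1 (coord q 0) (coord p 2)))%g.

Definition cell_block (lo hi : seq nat) : seq (seq nat) :=
  let range c := iota (coord lo c) (coord hi c - coord lo c).+1 in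
  [seq x :: yz | x <- range 0%N, yz <- [seq [:: y; z] | y <- range 1%N, z <- range 2%N]].

(** Triangles at the corner [lo] suffice: they make [cell_holonomy] a coboundary on the block. *)
Definition flat_block (lo hi : seq nat) : bool :=
  all (fun p => all (fun q =>
    (cell_holonomy lo p * cell_holonomy p q)%g == cell_holonomy lo q)
    (cell_block lo hi)) (cell_block lo hi).

Definition add_pt (p q : seq nat) : seq nat :=
  mkseq (fun c => (coord p c + coord q c)%N) 3.

(** The cells from [lo] to [lo + d] are those that meet along one face of the grid: a coordinate
    with d = 1 is fixed at the wall 2 lo + 1, one with d = 0 runs through the slab. The test asks
    whether this face lies on the stick [e]. *)
Definition knot_block (lo d : seq nat) (e : seq nat * seq nat) : bool :=
  all (fun c =>
    if coord d c == 1%N then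
      (minn (coord e.1 c) (coord e.2 c) <= 2 * coord lo c + 1 <=
       maxn (coord e.1 c) (coord e.2 c))%N
    else
      [&& 0 < coord lo c, coord lo c < coord walls c,
        minn (coord e.1 c) (coord e.2 c) <= 2 * coord lo c - 1 &
        2 * coord lo c + 1 <= maxn (coord e.1 c) (coord e.2 c)]%N) (iota 0 3).

(** Local consistency of the curtains around every face off the knot; on the vertical line below a
    crossing it amounts to the rule for the row colours. The first alternative discards blocks that
    leave the grid. *)
Lemma flat_or_knot_block :
  all (fun lo => all (fun d =>
      has (fun c => coord walls c < coord lo c + coord d c)%N (iota 0 3) ||
      flat_block lo (add_pt lo d) || has (knot_block lo d) knot_edges)
    (cell_block [:: 0; 0; 0] [:: 1; 1; 1])%N)
  (cell_block [:: 0; 0; 0] walls)%N.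
Proof. by vm_compute. Qed.

(** * Meridians of the columns and Neuwirth's relations *)

Definition eye : seq nat := [:: 0; 0; 4]%N.

(** From the plane z = 4 above the knot the path descends, passes under the column at x + 1 and
    climbs back. *)
Definition meridian (x y z : nat) : seq (seq nat) :=
  [:: [:: x; y; 4]; [:: x; y; z]; [:: x.+2; y; z]; [:: x.+2; y; 4]]%N.

(** For each column an even y strictly between its ends; at z = 2 the meridian runs below the
    columns and above the rows. *)
Definition column_level : seq nat := [:: 4; 4; 6; 4; 6]%N.

Definition column_word (i : nat) : seq (seq nat) :=
  rcons (meridian (2 * i) (nth 0%N column_level i) 2) eye.

(* The rows of a null-homotopy of the product of the meridians of all the
   columns [l] that meet the plane of height [y]: they are moved into that
   plane and lowered; then the detours through the eye are pulled down, and the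
   resulting loop, which goes around the whole slice of the knot, is moved off
   the knot. *)
Definition level_rows (l : seq nat) (y : nat) : seq (seq (seq nat)) :=
  let n := size l in
  let row (p : nat -> nat -> seq nat) :=
    [seq (if (k == n.-1) && (j == 4%N) then eye else p k j) | k <- iota 0 n, j <- iota 0 5] in
  let outer k j := ((k == 0%N) && (j == 0%N)) || ((k == n.-1) && (j == 3%N)) in
  let hook z k j := nth eye (meridian (2 * nth 0%N l k) y z) j in
  let joined k j := if j == 4%N then [:: 2 * nth 0%N l k.+1; y; 4]%N else hook 0%N k j in
  let lowered k j := if outer k j then joined k j else set_nth 0%N (joined k j) 2 0%N in
  let widened k j :=
    if (k == 0%N) && (j <= 1)%N then set_nth 0%N (lowered k j) 0 0%N
    else if (k == n.-1) && (1 < j)%N then set_nth 0%N (lowered k j) 0 10%N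
    else lowered k j in
  let shifted k j := set_nth 0%N (widened k j) 1 10%N in
  let raised k j := set_nth 0%N (shifted k j) 2 4%N in
  map row [:: hook 2; hook 0%N; joined; lowered; widened; shifted; raised].

(** The gaps between consecutive rows, each with the columns that cross it. *)
Definition levels : seq (seq nat * nat) :=
  [:: ([:: 0; 3], 2); ([:: 0; 1; 3; 4], 4); ([:: 1; 2; 3; 4], 6); ([:: 2; 4], 8)]%N.

Definition level_word (l : seq nat) := flatten (map column_word l).

Lemma level_rows_free : all (fun ly =>
  let rows := rcons (level_rows ly.1 ly.2) (nseq (5 * size ly.1) eye) in
  all (closed_word knot_edges eye) (level_word ly.1 :: rows) &&
  path (fun w w' => free_strip knot_edges eye w eye w') (level_word ly.1) rows) levels.
Proof. by vm_compute. Qed.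

Definition nat_cell (p : seq nat) : seq nat :=
  mkseq (fun c => minn (coord walls c) (uphalf (coord p c))) 3.

Definition meet_cell (p q : seq nat) : seq nat :=
  mkseq (fun c => minn (coord p c) (coord q c)) 3.

Definition join_cell (p q : seq nat) : seq nat :=
  mkseq (fun c => maxn (coord p c) (coord q c)) 3.

(** On a flat block the transport along an edge depends only on the cells of its end points, so
    [word_holonomy] computes the transport along a flat word. *)
Fixpoint flat_word (a : seq nat) (w : seq (seq nat)) : bool :=
  if w is b :: w' then
    flat_block (meet_cell (nat_cell a) (nat_cell b)) (join_cell (nat_cell a) (nat_cell b))
    && flat_word b w'
  else true.

Fixpoint word_holonomy (a : seq nat) (w : seq (seq nat)) : dih 'Z_3 :=
  if w is b :: w' then
    (cell_holonomy (nat_cell a) (nat_cell b) * word_holonomy b w')%g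
  else 1%g.

Lemma column_word_check : all (fun i =>
  [&& closed_word knot_edges eye (column_word i), flat_word eye (column_word i) &
      word_holonomy eye (column_word i) == reflection (inZp (nth 0%N column_color i))])
  (iota 0 5).
Proof. by vm_compute. Qed.

Lemma mem_cell_block (lo hi p : seq nat) : size p = 3%N ->
  (forall c, (c < 3)%N -> (coord lo c <= coord p c <= coord hi c)%N) ->
  p \in cell_block lo hi.
Proof.
case: p => [|x [|y [|z []]]] // _ loh; have := loh 0%N; have := loh 1%N; have := loh 2%N.
rewrite /= => /(_ isT) h2 /(_ isT) h1 /(_ isT) h0.
by apply: allpairs_f; [|apply: allpairs_f]; rewrite mem_iota; lia.
Qed.

(** * The holonomy representation of the complement *)

Section KnotGroup.
Context {R : realType}.
Notation V := 'rV[R]_3.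

Definition cell (v : V) : seq nat :=
  mkseq (fun c => wall_count (coord walls c) (v 0 (inord c))) 3.

Lemma nth_cell v (c : 'I_3) : coord (cell v) c = wall_count (coord walls c) (v 0 c).
Proof. by rewrite nth_mkseq// inord_val. Qed.

Lemma cell_vpt p : cell (vpt R p) = nat_cell p.
Proof.
apply/eq_in_map => c; rewrite mem_iota => /= c3.
by rewrite mxE inordK// wall_count_nat.
Qed.

Definition space_holonomy (v w : V) : dih 'Z_3 := cell_holonomy (cell v) (cell w).

Definition cell_range lo hi : set V :=
  [set v | forall c : 'I_3, (coord lo c <= coord (cell v) c <= coord hi c)%N].

Lemma flat_block_cocycle lo hi : flat_block lo hi ->
  cocycle_on space_holonomy (cell_range lo hi).
Proof.
move=> /allP flat.
have mem v : cell_range lo hi v -> cell v \in cell_block lo hi.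
  move=> vlh; apply: mem_cell_block; first by rewrite size_mkseq.
  by move=> c c3; have := vlh (Ordinal c3).
have flatE p q : p \in cell_block lo hi -> q \in cell_block lo hi ->
    cell_holonomy p q = ((cell_holonomy lo p)^-1 * cell_holonomy lo q)%g.
  by move=> /flat/allP h /h/eqP <-; rewrite mulKg.
move=> u v w /mem cu /mem cv /mem cw.
rewrite /space_holonomy (flatE _ _ cu cv) (flatE _ _ cv cw) (flatE _ _ cu cw).
by rewrite -mulgA mulVKg.
Qed.

(** [D] will be the complement of the embedded graph. It is squeezed between the complement of the
    thick boxes, where the homotopies take place, and the complement of the sticks, where the
    curtains define a local cocycle. *)
Variable D : set V.
Hypothesis thick_D : forall v, (forall e, e \in knot_edges -> ~ thick e v) -> D v.
Hypothesis D_edge : forall e (v : V), e \in knot_edges ->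
  (forall c : 'I_3, (minn (coord e.1 c) (coord e.2 c))%:R <= v 0 c
    <= (maxn (coord e.1 c) (coord e.2 c))%:R) -> ~ D v.

(** The slabs near v in the three coordinates form a block around a face that contains v; by
    [flat_or_knot_block] it is flat, for otherwise v would lie on a stick. *)
Lemma space_holonomy_near v : D v -> cocycle_near space_holonomy v.
Proof.
move=> Dv.
have /choice[lo /choice[d ld]] : forall c : 'I_3, exists lo d : nat, _ :=
  fun c => wall_count_near (coord walls c) (v 0 c).
pose los := mkseq (fun c => lo (inord c)) 3; pose ds := mkseq (fun c => d (inord c)) 3.
have losE (c : 'I_3) : coord los c = lo c by rewrite nth_mkseq// inord_val.
have dsE (c : 'I_3) : coord ds c = d c by rewrite nth_mkseq// inord_val.
have addE (c : 'I_3) : coord (add_pt los ds) c = (lo c + d c)%N.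
  by rewrite nth_mkseq// losE dsE.
have : los \in cell_block [:: 0; 0; 0]%N walls.
  apply: mem_cell_block; first by rewrite size_mkseq.
  move=> c c3; rewrite -[c]/(Ordinal c3 : nat) losE; case: (ld (Ordinal c3)) => _ h _ _.
  by rewrite (leq_trans _ h) ?leq_addr ?andbT//; case: c c3 {h} => [|[|[]]].
move/(allP flat_or_knot_block)/allP.
have : ds \in cell_block [:: 0; 0; 0]%N [:: 1; 1; 1]%N.
  apply: mem_cell_block; first by rewrite size_mkseq.
  move=> c c3; rewrite -[c]/(Ordinal c3 : nat) dsE; case: (ld (Ordinal c3)) => h _ _ _.
  by case: c c3 h => [|[|[]]].
move=> ds_block /(_ _ ds_block) /orP[/orP[|flat]|].
- case/hasP => c; rewrite mem_iota => /= c3.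
  rewrite -[c]/(Ordinal c3 : nat) losE dsE ltnNge; case: (ld (Ordinal c3)) => _ h _ _.
  by rewrite h.
- exists (cell_range los (add_pt los ds)); last exact: flat_block_cocycle.
  have near_c (c : 'I_3) : \forall w \near v,
      (coord los c <= coord (cell w) c <= coord (add_pt los ds) c)%N.
    have [_ _ _ nc] := ld c.
    have : nbhs v [set w : V | (lo c <= wall_count (coord walls c) (w 0%R c) <= lo c + d c)%N].
      exact: (@coord_continuous _ _ _ 0 c v) nc.
    by apply: filterS => w; rewrite nth_cell addE losE.
  exact: filter_forall near_c.
- case/hasP => e eK /allP kb; exfalso; apply: (D_edge eK _ Dv) => c.
  have : (c : nat) \in iota 0 3 by rewrite mem_iota/=.
  move/kb; rewrite losE dsE; case: (ld c) => _ _; case: ifP => _.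
    by move=> -> _ /andP[h1 h2]; rewrite !ler_nat h1 h2.
  move=> [l u] _ /and4P[/l l' /u u' h1 h2]; apply/andP; split.
    by rewrite (le_trans _ (ltW l'))// ler_nat.
  by rewrite (le_trans (ltW u'))// ler_nat.
Qed.

Lemma between_cell_range (a b : seq nat) (u : R) : 0 <= u <= 1 ->
  cell_range (meet_cell (nat_cell a) (nat_cell b)) (join_cell (nat_cell a) (nat_cell b))
    ((1 - u) *: vpt R a + u *: vpt R b).
Proof.
move=> u01 c; rewrite -!cell_vpt !nth_mkseq// !inord_val !mxE.
set x : R := (coord a c)%:R; set y : R := (coord b c)%:R.
have [xy|yx] := leP x y.
  rewrite geq_min leq_max; apply/andP; split; apply/orP; [left|right];
    apply: wall_count_mono; [exact: convex_ge|exact: convex_le].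
have := ltW yx => {}yx.
rewrite geq_min leq_max; apply/andP; split; apply/orP; [right|left];
  apply: wall_count_mono; [exact: convex_ge|exact: convex_le].
Qed.

Lemma polyline_holonomy a w :
  free_strip knot_edges a w a w -> flat_word a w -> w != [::] ->
  exists s, [/\ transport_lift space_holonomy
      (polyline (vpt R a) (map (vpt R) w)) 0 (size w)%:R s,
    s 0 = 1%g & s (size w)%:R = word_holonomy a w].
Proof.
elim: w a => // b w IHw a; rewrite free_strip_cons => /andP[sep str] /= /andP[flat fw] _.
have segment_D u : 0 <= u <= 1 -> D ((1 - u) *: vpt R a + u *: vpt R b).
  move=> u01; apply: thick_D => e /(allP sep)/(@separated_thick R)/(_ u 0 u01).
  by rewrite subr0 scale1r scale0r addr0 lexx ler01; apply.
have Da : D (vpt R a).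
  by have := segment_D 0; rewrite subr0 scale1r scale0r addr0 lexx ler01; apply.
have Db : D (vpt R b).
  by have := segment_D 1; rewrite subrr scale1r scale0r add0r lexx ler01; apply.
pose c := polyline (vpt R a) (map (vpt R) (b :: w)).
have cE t : 0 <= t <= 1 -> c t = (1 - t) *: vpt R a + t *: vpt R b.
  by case/andP=> _ t1; rewrite /c /= t1.
have c0 : c 0 = vpt R a by rewrite cE ?subr0 ?scale1r ?scale0r ?addr0// lexx ler01.
have c1 : c 1 = vpt R b by rewrite cE ?subrr ?scale1r ?scale0r ?add0r// lexx ler01.
have L1 : transport_lift space_holonomy c 0 1 (fun t => space_holonomy (c 0) (c t)).
  apply: transport_lift_cocycle (flat_block_cocycle flat) _ => t t01.
  by rewrite cE//; exact: between_cell_range.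
have haa := cocycle_near1 (space_holonomy_near Da).
have [w0|w0] := eqVneq w [::].
  subst w; rewrite [size _]/= (mulr1n (1 : R)); eexists; split; first exact: L1.
  - by cbv beta; rewrite c0 haa.
  - by cbv beta; rewrite c0 c1 /space_holonomy !cell_vpt /= mulg1.
have [s [sL s0 s1]] := IHw b str fw w0.
have L2 : transport_lift space_holonomy c 1 (size w).+1%:R
    (fun t => (space_holonomy (c 0%R) (c 1%R) * s (t - 1)%R)%g).
  apply: transport_lift_mul.
  have c_shift : continuous (fun t : R => t - 1).
    by move=> t; apply: cvgB; [exact: cvg_id|exact: cvg_cst].
  have D1 (t : R) : 1 <= t <= (size w).+1%:R -> 0 <= t - 1 <= (size w)%:R.
    by move=> /andP[t1 tw]; rewrite subr_ge0 t1 lerBlDr natr1.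
  apply: transport_lift_eq (transport_lift_comp c_shift D1 sL) => // t /andP[t1 _].
  rewrite /c /=; case: lerP => // t1'; have -> : t = 1 by lra.
  by rewrite !subrr polyline0 scale0r scale1r add0r.
have n1 : (0 <= (1 : R) <= (size w).+1%:R) by rewrite ler01 ler1n.
have nb : cocycle_near space_holonomy (c 1) by rewrite c1; exact: space_holonomy_near.
eexists; split; first apply: (transport_lift_cat nb _ n1 L1 L2).
- exact: polyline_continuous.
- by rewrite subrr s0 mulg1.
- by rewrite /= ler01 c0 haa.
- rewrite /= ifF; last by apply/negbTE; rewrite -ltNge ltr1n ltnS lt0n size_eq0.
  by rewrite -natr1 addrK s1 c0 c1 /space_holonomy !cell_vpt.
Qed.

Lemma eye_in : D (vpt R eye).
Proof.
apply: thick_D => e eK; have : separated [:: eye; eye; eye; eye] e.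
  by move: e eK; apply/allP; vm_compute.
move/(@separated_thick R)/(_ 0 0); rewrite subr0 !scale1r !scale0r !addr0 lexx ler01.
exact.
Qed.

Definition eye_point : set_type D := SigSub (mem_set eye_in).

Let eye_pointE : set_val eye_point = vpt R eye. Proof. by []. Qed.

Definition complement_transport (p q : set_type D) : dih 'Z_3 :=
  space_holonomy (set_val p) (set_val q).

Lemma complement_transport_near x : cocycle_near complement_transport x.
Proof.
have [U Ux cU] := space_holonomy_near (set_mem (valP x)).
exists (set_val @^-1` U); first exact: (@initial_continuous _ _ set_val).
by move=> p q r; exact: cU.
Qed.

Lemma word_loop_holonomy w (cw : closed_word knot_edges eye w) : flat_word eye w ->
  holonomy_hom complement_transport_near eye_point
    (loop_class (word_loop thick_D eye_pointE cw)) = word_holonomy eye w.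
Proof.
move=> fw; apply: holonomyE; first exact: complement_transport_near.
have /and3P[w0 _ str] := cw; have [s [sL s0 s1]] := polyline_holonomy str fw w0.
exists (fun t => s ((size w)%:R * t)); split; rewrite ?mulr0 ?mulr1//.
have c_mul : continuous (fun t : R => (size w)%:R * t).
  by move=> t; apply: cvgM; [exact: cvg_cst|exact: cvg_id].
have D1 (t : R) : 0 <= t <= 1 -> 0 <= (size w)%:R * t <= (size w)%:R.
  by move=> /andP[t0 t1]; rewrite mulr_ge0//= ler_piMr.
suff : transport_lift space_holonomy
    (fun t => set_val (loop_curve (word_loop thick_D eye_pointE cw) t)) 0 1
    (fun t => s ((size w)%:R * t)) by [].
apply: transport_lift_eq (transport_lift_comp c_mul D1 sL) => // t /andP[t0 t1].
rewrite /loop_curve word_loopE /word_curve ival_clamp.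
by rewrite (min_idPr t1) (max_idPr t0).
Qed.

Lemma knot_complement_not_free :
  exists x0 : set_type D, ~ free_group (fundamental_group R x0).
Proof.
exists eye_point.
have check i : (i < 5)%N -> [/\ closed_word knot_edges eye (column_word i),
    flat_word eye (column_word i) &
    word_holonomy eye (column_word i) = reflection (inZp (nth 0%N column_color i))].
  move=> i5; have : i \in iota 0 5 by rewrite mem_iota.
  by move/(allP column_word_check)/and3P => [cw fw /eqP].
have cw i : (i < 5)%N -> closed_word knot_edges eye (column_word i) by case/check.
pose m i (i5 : (i < 5)%N) := loop_class (word_loop thick_D eye_pointE (cw i i5)).
have holm i i5 : holonomy_hom complement_transport_near eye_point (m i i5) =
    reflection (inZp (nth 0%N column_color i)).
  by rewrite word_loop_holonomy; have [] := check i i5.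
have rel l y (cl : closed_word knot_edges eye (level_word l)) : (l, y) \in levels ->
    loop_class (word_loop thick_D eye_pointE cl) = pi1_one eye_point.
  move=> /(allP level_rows_free)/andP[/andP[_ crows] pth].
  exact: (@word_loop_trivial _ _ _ thick_D _ _ eye_pointE _ (level_rows l y)
    (5 * size l) cl crows pth).
have cl l y : (l, y) \in levels -> closed_word knot_edges eye (level_word l).
  by case/(allP level_rows_free)/andP => /andP[].
have rel2 i j y (i5 : (i < 5)%N) (j5 : (j < 5)%N) : ([:: i; j], y) \in levels ->
    (m i i5 * m j j5 = 1)%g.
  move=> ijy; have c := cl _ _ ijy; rewrite -[RHS](rel _ _ c ijy).
  have c' : closed_word knot_edges eye (column_word i ++ column_word j).
    by rewrite -[column_word j]cats0; exact: c.
  rewrite -[LHS](word_loop_cat thick_D eye_pointE _ _ c')//.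
  by apply/loop_classP/eq_word_loop; rewrite -[column_word j]cats0.
(* [word_loop_cat] asks for factors of equal length, hence the bracketing of the four meridians in
   pairs. *)
have rel4 i j k l y (i5 : (i < 5)%N) (j5 : (j < 5)%N) (k5 : (k < 5)%N) (l5 : (l < 5)%N)
    (cij : closed_word knot_edges eye (column_word i ++ column_word j))
    (ckl : closed_word knot_edges eye (column_word k ++ column_word l)) :
    ([:: i; j; k; l], y) \in levels ->
    ((m i i5 * m j j5) * (m k k5 * m l l5) = 1)%g.
  move=> ijy; have c := cl _ _ ijy; rewrite -[RHS](rel _ _ c ijy).
  have c' : closed_word knot_edges eye
      ((column_word i ++ column_word j) ++ (column_word k ++ column_word l)).
    by rewrite -catA -[column_word l]cats0; exact: c.
  rewrite -[(m i _ * _)%g](word_loop_cat thick_D eye_pointE _ _ cij)//.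
  rewrite -[(m k _ * _)%g](word_loop_cat thick_D eye_pointE _ _ ckl)//.
  rewrite -[LHS](word_loop_cat thick_D eye_pointE _ _ c')//.
  by apply/loop_classP/eq_word_loop; rewrite -catA -[column_word l]cats0.
have hol i (i5 : (i < 5)%N) a : inZp (nth 0%N column_color i) = a :> 'Z_3 ->
    holonomy_hom complement_transport_near eye_point (m i i5) = reflection a.
  by move=> <-; exact: holm.
apply: (@trefoil_not_free _ (m 0%N isT) (m 1%N isT) (m 2%N isT) (m 3%N isT) (m 4%N isT)
  (holonomy_hom complement_transport_near eye_point)).
- by apply: (rel2 _ _ 2%N).
- by apply: (rel4 _ _ _ _ 4%N); vm_compute.
- by apply: (rel4 _ _ _ _ 6%N); vm_compute.
- by apply: (rel2 _ _ 8%N).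
- by apply: hol; exact: val_inj.
- by apply: hol; exact: val_inj.
- by apply: hol; exact: val_inj.
- by apply: hol; exact: val_inj.
- by apply: hol; exact: val_inj.
Qed.

End KnotGroup.

(** * Straight-line embeddings *)

Lemma continuous_ptws (R : realType) (T : topologicalType) (I : Type)
    (h : T -> {ptws I -> R}) :
  (forall i, continuous (fun t => h t i)) -> continuous h.
Proof.
move=> ch t; apply/cvg_sup => i.
suff : continuous (h : T -> initial_topology (fun f : {ptws I -> R} => f i)) by apply.
by apply: continuous_comp_initial; exact: ch.
Qed.

Lemma edgesP (G : sgraph) (e : {set G}) :
  reflect (exists u v, adj u v /\ e = [set u; v]%SET) (e \in edges G).
Proof.
apply: (iffP imset2P) => [[u v _ uv ->]|[u [v [uv ->]]]]; first by exists u, v.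
by exists u v.
Qed.

Lemma valency_card (G : sgraph) (v : G) : valency v = #|[set w | adj v w]%SET|.
Proof.
have -> : valency v = #|[set [set v; w] | w in [set w | adj v w]]%SET|.
  congr #|pred_of_set _|; apply/setP => e; rewrite !inE.
  apply/andP/imsetP => [[/edgesP[x [y [xy ->]]]]|[w + ->]]; rewrite !inE.
    case/orP => /eqP ->; first by exists y; rewrite ?inE.
    by exists x; rewrite ?inE 1?adj_sym// finset.setUC.
  by move=> vw; rewrite eqxx; split=> //; apply/edgesP; exists v, w.
rewrite card_in_imset// => x y; rewrite !inE => vx vy /setP/(_ x).
rewrite !inE eqxx orbT => /esym/orP[/eqP xv|/eqP//].
by move: vx; rewrite xv adj_irrefl.
Qed.

Section StraightLine.
Context {R : realType} {G : sgraph}.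
Variable P : G -> 'rV[R]_3.

(** The case u = v yields the vertices, so that every point of the realization has this form. *)
Definition segpt (u v : G) (t : R) : {ptws G -> R} :=
  fun w => (1 - t) * (w == u)%:R + t * (w == v)%:R.

Definition straight_map (x : {ptws G -> R}) : 'rV[R]_3 := \sum_v x v *: P v.

Lemma sum_indicator (V : lmodType R) (F : G -> V) u :
  \sum_w (w == u)%:R *: F w = F u.
Proof.
rewrite (bigD1 u)//= eqxx scale1r big1 ?addr0// => w /negbTE ->.
by rewrite scale0r.
Qed.

Lemma straight_map_segpt u v t :
  straight_map (segpt u v t) = (1 - t) *: P u + t *: P v.
Proof.
rewrite /straight_map; under eq_bigr do rewrite scalerDl -!scalerA.
by rewrite big_split/= -!scaler_sumr !sum_indicator.
Qed.

Lemma segpt_realization u v t : (u == v) || adj u v -> 0 <= t <= 1 ->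
  realization_set (segpt u v t).
Proof.
move=> uv /andP[t0 t1]; split.
- by move=> w; rewrite addr_ge0// mulr_ge0// subr_ge0.
- rewrite big_split /= -!mulr_sumr -!natr_sum.
  have one (z : G) : (\sum_w (w == z))%N = 1%N.
    by rewrite (bigD1 z)//= eqxx big1 ?addn0// => w /negbTE ->.
  by rewrite !one !mulr1 subrK.
- case/orP: uv => [/eqP <-|uv]; [left|right].
    by exists u => w /negbTE wu; rewrite /segpt wu !mulr0 addr0.
  exists [set u; v]%SET; first by apply/edgesP; exists u, v.
  by move=> w; rewrite !inE negb_or => /andP[/negbTE wu /negbTE wv];
    rewrite /segpt wu wv !mulr0 addr0.
Qed.

Lemma segptP (x : {ptws G -> R}) u v : realization_set x -> u != v ->
  (forall w, w \notin [set u; v]%SET -> x w = 0) ->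
  0 <= x v <= 1 /\ x = segpt u v (x v).
Proof.
move=> [x0 x1 _] uv xuv.
have sum2 : x u + x v = 1.
  rewrite -x1 (bigD1 u)//= (bigD1 v) 1?eq_sym//= big1 ?addr0// => w /andP[wu wv].
  by apply: xuv; rewrite !inE negb_or wu.
split; first by rewrite x0 -sum2 lerDr x0.
apply/funext => w; rewrite /segpt; have [->|wu] := eqVneq w u.
  by rewrite (negbTE uv) mulr0 addr0 mulr1 -sum2 addrK.
have [->|wv] := eqVneq w v; first by rewrite mulr0 add0r mulr1.
by rewrite !mulr0 addr0 xuv// !inE negb_or wu.
Qed.

Lemma realizationP (x : {ptws G -> R}) : realization_set x ->
  exists u v t, [/\ (u == v) || adj u v, 0 <= t <= 1 & x = segpt u v t].
Proof.
move=> xG; have [x0 x1 [[v xv]|[e /edgesP[u [v [uv ->]]] xe]]] := xG.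
  exists v, v, 0; split; rewrite ?eqxx ?lexx ?ler01//; apply/funext => w.
  rewrite /segpt subr0 mul1r mul0r addr0; have [->|/xv//] := eqVneq w v.
  by rewrite -x1 (bigD1 v)//= big1 ?addr0.
have nuv : u != v by apply: contraTneq uv => ->; rewrite adj_irrefl.
by have [] := segptP xG nuv xe; exists u, v, (x v); rewrite uv orbT.
Qed.

Lemma segpt_continuous u v : continuous (segpt u v).
Proof.
apply: continuous_ptws => w t; apply: cvgD; apply: cvgM; try exact: cvg_cst.
  by apply: cvgB; [exact: cvg_cst|exact: cvg_id].
exact: cvg_id.
Qed.

Lemma straight_map_continuous : continuous straight_map.
Proof.
suff sum_continuous r : continuous (fun x : {ptws G -> R} => \sum_(v <- r) x v *: P v).
  exact: sum_continuous.
elim: r => [|v r IHr].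
  have -> : (fun x : {ptws G -> R} => \sum_(v <- [::]) x v *: P v) = fun=> 0.
    by apply/funext => x; rewrite big_nil.
  exact: cst_continuous.
have -> : (fun x : {ptws G -> R} => \sum_(w <- v :: r) x w *: P w) =
    (fun x => x v *: P v + \sum_(w <- r) x w *: P w).
  by apply/funext => x; rewrite big_cons.
have cv : continuous (fun x : {ptws G -> R} => x v *: P v).
  apply: (@continuous_compose _ _ _ (fun x : {ptws G -> R} => x v) (fun a : R => a *: P v)).
    exact: (@proj_continuous _ (fun=> R) v).
  by move=> a; apply: cvgZr_tmp; exact: cvg_id.
apply: (@continuous_compose _ _ _ (fun x : {ptws G -> R} =>
  (x v *: P v, \sum_(w <- r) x w *: P w)) (fun z : 'rV[R]_3 * 'rV[R]_3 => z.1 + z.2)).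
  exact: continuous_pair cv IHr.
exact: add_continuous.
Qed.

Definition straight_embedding (x : realization R G) : 'rV[R]_3 :=
  straight_map (set_val x).

(** Openness onto the image comes from compactness: the points outside an open set are mapped onto a
    finite union of compact sets [K uv], one for each vertex or oriented edge, and this union is
    closed. *)
Lemma straight_linear_embedding :
  (forall x y, realization_set x -> realization_set y ->
    straight_map x = straight_map y -> x = y) ->
  linear_embedding straight_embedding.
Proof.
move=> inj; have inj_s : injective straight_embedding.
  by move=> x y xy; apply: val_inj; apply: inj xy; exact: set_valP.
split; last first.
  move=> e /edgesP[u [v [uv ->]]]; exists (P u), (P v).
  have nuv : u != v by apply: contraTneq uv => ->; rewrite adj_irrefl.
  apply/seteqP; split=> [y [x xe <-]|y [t t01 <-]].
    have [t01 xE] := segptP (set_valP x) nuv xe.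
    exists (set_val x v : R); first by rewrite /= in_itv.
    by rewrite -straight_map_segpt -xE.
  move: t01; rewrite /= in_itv /= => t01.
  have xG : segpt u v t \in @realization_set R G.
    by rewrite inE; apply: segpt_realization; rewrite ?uv ?orbT.
  exists (SigSub xG); last by rewrite /straight_embedding /= straight_map_segpt.
  move=> w; rewrite /= !inE negb_or => /andP[/negbTE wu /negbTE wv].
  by change (segpt u v t w = 0); rewrite /segpt wu wv !mulr0 addr0.
split=> //.
  exact: (continuous_compose (@initial_continuous _ _ set_val) straight_map_continuous).
move=> U [W Wo WU].
pose K (uv : G * G) := (fun t : R => (1 - t) *: P uv.1 + t *: P uv.2) @`
  (`[0, 1] `&` segpt uv.1 uv.2 @^-1` (~` W)).
have Kc uv : compact (K uv).
  apply: continuous_compact.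
    apply: continuous_subspaceT => t; apply: cvgD; apply: cvgZr_tmp; last exact: cvg_id.
    by apply: cvgB; [exact: cvg_cst|exact: cvg_id].
  apply: (subclosed_compact _ (@segment_compact R 0 1)); last by move=> t [].
  apply: closedI; first exact: interval_closed.
  by move: (@segpt_continuous uv.1 uv.2) => /continuous_closedP; apply; exact: open_closedC.
have KU : compact (\big[setU/set0]_(uv : G * G | (uv.1 == uv.2) || adj uv.1 uv.2) K uv).
  by apply: bigsetU_compact => uv _; exact: Kc.
exists (~` \big[setU/set0]_(uv : G * G | (uv.1 == uv.2) || adj uv.1 uv.2) K uv).
  by apply: closed_openC; exact: (compact_closed (@norm_hausdorff R 'rV[R]_3) KU).
rewrite -WU -bigcup_seq_cond; apply/seteqP; split=> x /= Wx.
  move=> [[u v] /= /andP[_ uv] [t [t01 nW] xE]]; apply: nW.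
  rewrite -(_ : set_val x = segpt u v t)//; apply: inj.
  - exact: set_valP.
  - by apply: segpt_realization => //; move: t01; rewrite /= in_itv.
  - by rewrite straight_map_segpt xE.
apply: contrapT => nWx; apply: Wx.
have [u [v [t [uv t01 xE]]]] := realizationP (set_valP x).
exists (u, v) => /=; first by rewrite mem_index_enum.
exists t; last by rewrite -straight_map_segpt -xE.
by split; [rewrite /= in_itv|change (~ W (segpt u v t)); rewrite -xE].
Qed.

End StraightLine.

(** * The graphs *)

Definition knot_vertex (a : nat) : seq nat := nth [::] knot a.

Definition next_vertex (a : nat) : nat := (a.+1 %% 20)%N.

(** The sticks a and a + 1 form a right angle: some coordinate varies on the first only, another on
    the second only. *)
Definition knot_turn (a : nat) : bool :=
  let p := knot_vertex a in let q := knot_vertex (next_vertex a) in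
  let r := knot_vertex (next_vertex (next_vertex a)) in
  has (fun c => (coord p c != coord q c) && (coord q c == coord r c)) (iota 0 3) &&
  has (fun c => (coord q c != coord r c) && (coord p c == coord q c)) (iota 0 3).

Definition disjoint_sticks (a b : nat) : bool :=
  has (fun c =>
    (maxn (coord (knot_vertex a) c) (coord (knot_vertex (next_vertex a)) c) <
     minn (coord (knot_vertex b) c) (coord (knot_vertex (next_vertex b)) c))%N) (iota 0 3).

Lemma knot_sticks : all (fun a => all (fun b =>
    [|| a == b, disjoint_sticks a b, disjoint_sticks b a,
        (b == next_vertex a) && knot_turn a | (a == next_vertex b) && knot_turn b])
  (iota 0 20)) (iota 0 20).
Proof. by vm_compute. Qed.

Lemma knot_edgesE :
  knot_edges = [seq (knot_vertex a, knot_vertex (next_vertex a)) | a <- iota 0 20].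
Proof. by []. Qed.

Lemma stick_direction (a : nat) : (a < 20)%N -> exists c0 : 'I_3,
  coord (knot_vertex a) c0 != coord (knot_vertex (next_vertex a)) c0 /\
  forall c : 'I_3, c != c0 ->
    coord (knot_vertex a) c = coord (knot_vertex (next_vertex a)) c.
Proof.
move=> a20; pose one_direction b := has (fun c0 =>
    (coord (knot_vertex b) c0 != coord (knot_vertex (next_vertex b)) c0) &&
    all (fun c => (c == c0) || (coord (knot_vertex b) c == coord (knot_vertex (next_vertex b)) c))
      (iota 0 3)) (iota 0 3).
have : all one_direction (iota 0 20) by vm_compute.
move/allP/(_ a); rewrite mem_iota => /(_ a20)/hasP[c0].
rewrite mem_iota => c03 /andP[pq /allP eq]; exists (Ordinal c03); split=> // c cc0.
have : (c : nat) \in iota 0 3 by rewrite mem_iota/=.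
by move/eq/orP => [/eqP ec|/eqP//]; case/eqP: cc0; exact: val_inj.
Qed.

Lemma uniq_knot : uniq knot. Proof. by []. Qed.

Lemma knot_vertex_inj (a b : nat) : (a < 20)%N -> (b < 20)%N ->
  (forall c : 'I_3, coord (knot_vertex a) c = coord (knot_vertex b) c) -> a = b.
Proof.
move=> a20 b20 ab; apply/eqP; rewrite -(@nth_uniq _ [::] knot a b a20 b20 uniq_knot).
have size3 x : (x < 20)%N -> size (knot_vertex x) = 3%N.
  have all3 : all (fun p => size p == 3%N) knot by [].
  by move=> x20; apply/eqP; apply: (allP all3); exact: mem_nth.
apply/eqP/(@eq_from_nth _ 0%N); first by rewrite !size3.
move=> c; rewrite size3// => c3; exact: (ab (Ordinal c3)).
Qed.

(* Coefficients in barycentric coordinates are recovered from four moments,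
   because a polynomial of degree 3 isolates any one of four nodes. *)
Lemma moment_inj (R : realType) (T : eqType) (tau : T -> R) (u v u' v' : T) (t s : R) :
  injective tau ->
  (forall k, (k < 4)%N -> (1 - t) * tau u ^+ k + t * tau v ^+ k =
     (1 - s) * tau u' ^+ k + s * tau v' ^+ k) ->
  forall w, (1 - t) * (w == u)%:R + t * (w == v)%:R =
    (1 - s) * (w == u')%:R + s * (w == v')%:R.
Proof.
move=> tau_inj mom w.
have mom_poly (q : {poly R}) : (size q <= 4)%N ->
    (1 - t) * q.[tau u] + t * q.[tau v] = (1 - s) * q.[tau u'] + s * q.[tau v'].
  move=> q4; rewrite !(horner_coef_wide _ q4) !mulr_sumr -!big_split /=.
  apply: eq_bigr => k _; rewrite ![_ * (q`_k * _)]mulrCA -!mulrDr.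
  by rewrite mom.
(* The product [q] vanishes at those of the four nodes that differ from [w], but not at [w]. As [w]
   is one of the four, at least one factor is 1 and the degree is at most 3. *)
pose F z := if z == w then 1 else 'X - (tau z)%:P.
pose q := F u * F v * F u' * F v'.
have sF z : size (F z) = (z != w).+1.
  by rewrite /F; case: eqVneq => _; rewrite ?size_poly1 ?size_XsubC.
have Fw z : (F z).[tau w] != 0.
  rewrite /F; case: (eqVneq z w) => [_|zw]; first by rewrite hornerE oner_eq0.
  by rewrite hornerXsubC subr_eq0; apply: contra zw => /eqP/tau_inj ->.
have Fz z : z != w -> (F z).[tau z] = 0.
  by rewrite /F => /negbTE ->; rewrite hornerXsubC subrr.
have [w4|] := boolP (w \in [:: u; v; u'; v']); last first.
  rewrite !inE !negb_or => /and4P[/negbTE -> /negbTE -> /negbTE -> /negbTE ->].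
  by rewrite !mulr0.
have q4 : (size q <= 4)%N.
  have := size_polyMleq (F u * F v * F u') (F v').
  have := size_polyMleq (F u * F v) (F u'); have := size_polyMleq (F u) (F v).
  move: w4; rewrite !inE /q !sF !(eq_sym w).
  by case: eqP; case: eqP; case: eqP; case: eqP => //= *; lia.
have q0 : q.[tau w] != 0 by rewrite !hornerM !mulf_neq0.
have qE z : z \in [:: u; v; u'; v'] -> q.[tau z] = (w == z)%:R * q.[tau w].
  rewrite !inE; have [<-|zw] := eqVneq w z; first by rewrite mul1r.
  rewrite mul0r; rewrite eq_sym in zw.
  by rewrite !hornerM => /or4P[] /eqP <-; rewrite Fz// ?mul0r ?mulr0 ?mul0r.
have := mom_poly q q4.
rewrite (qE u) ?(qE v) ?(qE u') ?(qE v') ?inE ?eqxx ?orbT// !mulrA -!mulrDl.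
exact: mulIf.
Qed.

Lemma nat_frac_eq (R : realType) (p q : nat) (x y : R) : 0 <= x < 1 -> 0 <= y < 1 ->
  p%:R + x = q%:R + y -> p = q.
Proof.
move=> /andP[x0 x1] /andP[y0 y1] pq.
have h1 : (p < q.+1)%N by rewrite -(ltr_nat R) -natr1; lra.
have h2 : (q < p.+1)%N by rewrite -(ltr_nat R) -natr1; lra.
lia.
Qed.

Lemma segment_start (R : realType) (x y t : R) : (1 - t) * x + t * y = x -> x != y -> t = 0.
Proof.
move=> h; rewrite eq_sym -subr_eq0 => /mulIf; apply.
by rewrite mul0r; apply: (addrI x); rewrite addr0 -[RHS]h; ring.
Qed.

Lemma segment_end (R : realType) (x y t : R) : (1 - t) * x + t * y = y -> x != y -> t = 1.
Proof.
move=> h; rewrite eq_sym => yx; apply/esym/eqP; rewrite -subr_eq0; apply/eqP.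
apply: (@segment_start R y x) => //; rewrite -[RHS]h; ring.
Qed.

Lemma ordS20_neq (a : 'I_20) : ordS a != a.
Proof. by apply/eqP => /(congr1 val) /=; case: a => a a20 /=; lia. Qed.

Section KnotGraph.
Variables (n i : nat).
Notation vertices := ('I_20 * 'I_(n + i).+1)%type.

(* The clusters are joins of a complete graph on n vertices with i.+1
   independent vertices; their vertices 0 are the vertices of the knot. *)
Definition knot_adj : rel vertices := fun u v =>
  [&& u.1 == v.1, u.2 != v.2 & (u.2 < n)%N || (v.2 < n)%N] ||
  [&& u.2 == ord0, v.2 == ord0 & (v.1 == ordS u.1) || (u.1 == ordS v.1)].

Lemma knot_adj_sym : symmetric knot_adj.
Proof.
move=> u v; rewrite /knot_adj (eq_sym u.1 v.1) (eq_sym u.2 v.2) (orbC (u.2 < n)%N).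
by rewrite (orbC (v.1 == ordS u.1)); congr (_ || _); rewrite andbCA.
Qed.

Lemma knot_adj_irrefl : irreflexive knot_adj.
Proof.
by move=> u; rewrite /knot_adj !eqxx orbb (eq_sym u.1) (negbTE (ordS20_neq _)) /= !andbF.
Qed.

Definition knot_graph : sgraph := SGraph knot_adj_sym knot_adj_irrefl.

Lemma card_knot_graph : #|knot_graph| = (20 * (n + i).+1)%N.
Proof. by rewrite /= card_prod !card_ord. Qed.

Lemma knot_graph_connected : (0 < n)%N -> graph_connected knot_graph.
Proof.
move=> n_gt0.
split; first by rewrite card_knot_graph.
have sym : connect_sym (@adj knot_graph) := sym_connect_sym knot_adj_sym.
pose o : knot_graph := (ord0, ord0).
have cycle_o k (k20 : (k < 20)%N) : connect (@adj knot_graph) o (Ordinal k20, ord0).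
  elim: k k20 => [|k IHk] k20.
    by rewrite (_ : (Ordinal k20, ord0) = o) ?connect0//; congr (_, _); exact: val_inj.
  apply: connect_trans (IHk (ltnW k20)) _; apply: connect1.
  rewrite /= /knot_adj /=; apply/or3P; apply: Or32.
  by apply/eqP/val_inj; rewrite /= modn_small.
have to_o x : connect (@adj knot_graph) o x.
  case: x => [[a a20] j]; apply: connect_trans (cycle_o a a20) _.
  have [->|j0] := eqVneq j ord0; first exact: connect0.
  by apply: connect1; rewrite /= /knot_adj /= ?eqxx eq_sym j0 n_gt0.
by move=> x y; apply: connect_trans (to_o y); rewrite sym.
Qed.

Lemma knot_graph_min_valency : (0 < n)%N -> min_valency_is knot_graph n.
Proof.
move=> n_gt0.
have small (a : 'I_20) :
    #|[set w : knot_graph | (w.1 == a) && (w.2 < n)%N]%SET| = n.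
  have nm : (n <= (n + i).+1)%N by lia.
  rewrite -[RHS](card_ord n) -cardsT.
  rewrite -(@card_imset _ _ (fun k : 'I_n => (a, widen_ord nm k) : knot_graph)).
    apply: eq_card => -[b j]; rewrite !inE /=; apply/andP/imsetP => [[/eqP -> jn]|[k _ [-> ->]]].
      by exists (Ordinal jn); rewrite ?inE//; congr (_, _); exact: val_inj.
    by split; [exact: eqxx|exact: (ltn_ord k)].
  by move=> k l [] /val_inj.
split.
  have nm : (n < (n + i).+1)%N by lia.
  (* Index n belongs to the independent part, and n > 0 keeps this vertex off the knot, so its
     neighbours are exactly the n vertices of the complete part. *)
  exists (ord0, Ordinal nm); rewrite valency_card -[RHS](small ord0).
  apply: eq_card => -[b j]; rewrite !inE /= /knot_adj /= ltnn /= (eq_sym ord0 b).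
  rewrite (_ : (Ordinal nm == ord0) = false) /= ?orbF; last first.
    by apply/eqP => /(congr1 val) /= n0; move: n_gt0; rewrite n0.
  case: eqP => //= _; rewrite -val_eqE /=; case: ltngtP => //.
(* An independent vertex is joined to the n complete ones, and a complete vertex to the n + i other
   vertices of its cluster. *)
move=> [a j]; rewrite valency_card; have [jn|nj] := ltnP j n; last first.
  rewrite -[X in (X <= _)%N](small a); apply: subset_leq_card; apply/fintype.subsetP => -[b l].
  rewrite !inE /= /knot_adj /= => /andP[/eqP -> ln]; rewrite eqxx ln orbT andbT /=.
  by apply/orP; left; apply: contraTneq ln => <-; rewrite -leqNgt.
have nm : (n <= #|[set l : 'I_(n + i).+1 | l != j]%SET|)%N.
  rewrite (_ : [set l | l != j]%SET = [set~ j]%SET).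
    by rewrite cardsC1 card_ord; lia.
  by apply/setP => l; rewrite !inE.
apply: leq_trans nm _.
rewrite -(@card_imset _ _ (fun l => (a, l) : knot_graph)); last by move=> k l [].
apply: subset_leq_card; apply/fintype.subsetP => _ /imsetP[l + ->].
by rewrite !inE /= /knot_adj /= eqxx jn eq_sym => ->.
Qed.

(** * The straight-line embedding of the graphs *)

Section Embedding.
Variable R : realType.

(** Nodes in [0, 1) keep each cluster in the half-open unit cube at its corner, and node 0 gives the
    corner itself. *)
Definition cluster_node (j : 'I_(n + i).+1) : R := j%:R / (n + i).+1%:R.

Lemma cluster_node_ge0 j : 0 <= cluster_node j.
Proof. by rewrite divr_ge0. Qed.

Lemma cluster_node_lt1 j : cluster_node j < 1.
Proof. by rewrite ltr_pdivrMr ?ltr0n// mul1r ltr_nat. Qed.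

Lemma cluster_node_inj : injective cluster_node.
Proof.
move=> j l /mulIf h; apply: val_inj; apply/eqP; rewrite -(eqr_nat R); apply/eqP/h.
by rewrite invr_eq0 pnatr_eq0.
Qed.

Lemma cluster_node_eq0 j k : (cluster_node j ^+ k.+1 == 0) = (j == ord0).
Proof.
by rewrite expf_eq0 /= mulf_eq0 invr_eq0 !pnatr_eq0 orbF.
Qed.

Definition knot_position (u : knot_graph) : 'rV[R]_3 :=
  vpt R (knot_vertex u.1) + \row_c cluster_node u.2 ^+ c.+1.

Lemma knot_positionE u c :
  knot_position u 0 c = (coord (knot_vertex u.1) c)%:R + cluster_node u.2 ^+ c.+1.
Proof. by rewrite !mxE. Qed.

Lemma knot_position0 (a : 'I_20) c :
  knot_position (a, ord0) 0 c = (coord (knot_vertex a) c)%:R.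
Proof.
by rewrite knot_positionE; have /eqP -> := cluster_node_eq0 ord0 c; rewrite addr0.
Qed.

Notation segpt := (@segpt R knot_graph).
Notation smap := (straight_map knot_position).

Lemma segpt_sym u v t : segpt u v t = segpt v u (1 - t).
Proof. by apply/funext => w; rewrite /segpt; ring. Qed.

Lemma knot_realizationP x : @realization_set R knot_graph x ->
  (exists a j l t, 0 <= t <= 1 /\ x = segpt (a, j) (a, l) t) \/
  (exists a t, 0 <= t <= 1 /\ x = segpt (a, ord0) (ordS a, ord0) t).
Proof.
move=> /realizationP[[a j] [[b l] [t [uv t01 ->]]]].
have flip : 0 <= 1 - t <= 1 by case/andP: t01 => t0 t1; rewrite subr_ge0 t1 gerBl.
case/orP: uv => [/eqP[-> ->]|]; first by left; exists b, l, l, t.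
rewrite /= /knot_adj /= => /orP[/and3P[/eqP -> _ _]|/and3P[/eqP -> /eqP ->]].
  by left; exists b, j, l, t.
case/orP => /eqP ->; right; first by exists a, t.
by exists b, (1 - t); rewrite -segpt_sym.
Qed.

Lemma cluster_coord a j l t (c : 'I_3) : 0 <= t <= 1 ->
  let y := (1 - t) * cluster_node j ^+ c.+1 + t * cluster_node l ^+ c.+1 in
  smap (segpt (a, j) (a, l) t) 0 c = (coord (knot_vertex a) c)%:R + y /\ 0 <= y < 1.
Proof.
move=> t01 y; split.
  by rewrite straight_map_segpt !mxE /= /y; ring.
have lt1 z : cluster_node z ^+ c.+1 < 1.
  by rewrite exprn_ilt1// ?cluster_node_ge0 ?cluster_node_lt1.
have ge0 z : 0 <= cluster_node z ^+ c.+1 by rewrite exprn_ge0// cluster_node_ge0.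
apply/andP; split; first exact: convex_ge.
apply: (@le_lt_trans _ _ (Num.max (cluster_node j ^+ c.+1) (cluster_node l ^+ c.+1))).
  by apply: convex_le => //; rewrite le_max lexx ?orbT.
by rewrite gt_max !lt1.
Qed.

Lemma stick_coord (a : 'I_20) t (c : 'I_3) :
  smap (segpt (a, ord0) (ordS a, ord0) t) 0 c =
  (1 - t) * (coord (knot_vertex a) c)%:R +
  t * (coord (knot_vertex (next_vertex a)) c)%:R.
Proof. by rewrite straight_map_segpt mxE [in LHS]mxE [X in _ + X]mxE !knot_position0. Qed.

Lemma sticks_inj (a b : 'I_20) t s : 0 <= t <= 1 -> 0 <= s <= 1 ->
  smap (segpt (a, ord0) (ordS a, ord0) t) = smap (segpt (b, ord0) (ordS b, ord0) s) ->
  segpt (a, ord0) (ordS a, ord0) t = segpt (b, ord0) (ordS b, ord0) s.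
Proof.
wlog: a b t s / (a == b) || disjoint_sticks a b || (b == next_vertex a :> nat) && knot_turn a.
  move=> hw t01 s01 ab.
  have /allP/(_ a) := knot_sticks; rewrite mem_iota => /(_ (ltn_ord a))/allP/(_ b).
  rewrite mem_iota => /(_ (ltn_ord b)) /or4P[e|e|e|/orP[e|e]].
  - by apply: hw => //; rewrite -val_eqE e.
  - by apply: hw => //; rewrite e orbT.
  - by apply/esym/hw => //; rewrite e orbT.
  - by apply: hw => //; rewrite e !orbT.
  - by apply/esym/hw => //; rewrite e !orbT.
move=> hyp t01 s01 ab.
have abc c : smap (segpt (a, ord0) (ordS a, ord0) t) 0 c =
    smap (segpt (b, ord0) (ordS b, ord0) s) 0 c by rewrite ab.
move: hyp => /orP[/orP[/eqP e|]|].
- rewrite -e in abc *; have [c0 [pq _]] := stick_direction (ltn_ord a).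
  suff -> : t = s by [].
  have := abc c0; rewrite !stick_coord; set p := _%:R; set q := _%:R => h.
  have npq : q - p != 0 by rewrite subr_eq0 eq_sym eqr_nat.
  by apply: (mulIf npq); lra.
- case/hasP => c; rewrite mem_iota => /= c3 sep; have := abc (Ordinal c3).
  rewrite !stick_coord /= => h; exfalso.
  move: sep; rewrite ltnNge -(ler_nat R) => /negP; apply.
  apply: (@le_trans _ _ ((1 - s) * (coord (knot_vertex b) c)%:R +
      s * (coord (knot_vertex (next_vertex b)) c)%:R)).
    by apply: convex_ge => //; rewrite ler_nat ?geq_minl ?geq_minr.
  by rewrite -h; apply: convex_le => //; rewrite ler_nat ?leq_maxl ?leq_maxr.
(* In the coordinate c only the first stick moves, which forces t = 1; in d only the second moves,
   which forces s = 0. Both points are the common corner. *)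
- case/andP => /eqP bE /andP[/hasP[c + /andP[pq /eqP qr]] /hasP[d + /andP[qr' /eqP pq']]].
  rewrite !mem_iota /= => c3 d3.
  have bS : b = ordS a by apply: val_inj.
  have := abc (Ordinal c3); have := abc (Ordinal d3).
  rewrite !stick_coord /= bE -qr -pq' -[LHS]mulrDl subrK mul1r => hd hc.
  rewrite -[RHS]mulrDl subrK mul1r in hc.
  have -> : t = 1 by apply: segment_end hc _; rewrite eqr_nat.
  have -> : s = 0 by apply: segment_start (esym hd) _; rewrite eqr_nat pq'.
  by rewrite bS; apply/funext => w; rewrite /segpt; ring.
Qed.

(** In a coordinate fixed along the stick its points are integral, so the fractional part of the
    cluster point vanishes and all weight sits on node 0. The point is then the start of stick a,
    which reduces the case to [sticks_inj]. *)
Lemma cluster_stick (a b : 'I_20) j l t s : 0 <= t <= 1 -> 0 <= s <= 1 ->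
  smap (segpt (a, j) (a, l) t) = smap (segpt (b, ord0) (ordS b, ord0) s) ->
  segpt (a, j) (a, l) t = segpt (a, ord0) (ordS a, ord0) 0.
Proof.
move=> t01 s01 ab; have [c0 [_ fixc]] := stick_direction (ltn_ord b).
have [c cc0] : exists c : 'I_3, c != c0.
  by have [->|] := eqVneq c0 ord0; [exists ord_max|exists ord0; rewrite eq_sym].
have := cluster_coord a j l c t01; set y := (1 - t) * _ + _ => -[+ y01].
rewrite ab stick_coord (fixc c cc0) -mulrDl subrK mul1r => h.
have z01 : 0 <= (0 : R) < 1 by rewrite lexx ltr01.
have e := nat_frac_eq z01 y01 (etrans (addr0 _) h).
have y0 : y = 0 by apply: (addrI (coord (knot_vertex a) c)%:R); rewrite -h e addr0.
case/andP: t01 => t0 t1.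
have ge0 z : 0 <= cluster_node z ^+ c.+1 by rewrite exprn_ge0// cluster_node_ge0.
move/eqP: y0; rewrite /y paddr_eq0 ?mulr_ge0 ?subr_ge0//.
rewrite !mulf_eq0 !cluster_node_eq0 subr_eq0 => /andP[hj hl].
apply/funext => w; rewrite /segpt subr0 mul1r mul0r addr0.
case/orP: hj => [/eqP e1|/eqP ->].
  by move: hl; rewrite -e1 oner_eq0 => /eqP ->; rewrite subrr mul0r mul1r add0r.
case/orP: hl => [/eqP ->|/eqP ->]; first by rewrite subr0 mul1r mul0r addr0.
by rewrite -mulrDl subrK mul1r.
Qed.

(** Integer parts of the coordinates determine the cluster. The fractional parts are the moments of
    order 1 to 3, and the total weight is the moment of order 0, so [moment_inj] applies. *)
Lemma clusters_inj (a b : 'I_20) j l j' l' t s : 0 <= t <= 1 -> 0 <= s <= 1 ->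
  smap (segpt (a, j) (a, l) t) = smap (segpt (b, j') (b, l') s) ->
  segpt (a, j) (a, l) t = segpt (b, j') (b, l') s.
Proof.
move=> t01 s01 ab.
have e : a = b.
  apply: val_inj; apply: (knot_vertex_inj (ltn_ord a) (ltn_ord b)) => c.
  have [h1 y1] := cluster_coord a j l c t01; have [h2 y2] := cluster_coord b j' l' c s01.
  by apply: (nat_frac_eq y1 y2); rewrite -h1 -h2 ab.
rewrite e in ab *.
have mom : forall w, (1 - t) * (w == j)%:R + t * (w == l)%:R =
    (1 - s) * (w == j')%:R + s * (w == l')%:R.
  apply: (moment_inj cluster_node_inj) => -[|k] k4; first by rewrite !expr0 !mulr1 !subrK.
  have [h1 _] := cluster_coord b j l (Ordinal (k4 : (k < 3)%N)) t01.
  have [h2 _] := cluster_coord b j' l' (Ordinal (k4 : (k < 3)%N)) s01.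
  by move: h1; rewrite ab h2 => /addrI /esym.
apply/funext => -[x z]; rewrite /segpt !xpair_eqE.
by case: (x == b); rewrite /= ?mom// !mulr0.
Qed.

Lemma knot_position_inj x y :
  @realization_set R knot_graph x -> @realization_set R knot_graph y ->
  smap x = smap y -> x = y.
Proof.
move=> /knot_realizationP[[a [j [l [t [t01 ->]]]]]|[a [t [t01 ->]]]];
  move=> /knot_realizationP[[b [j' [l' [s [s01 ->]]]]]|[b [s [s01 ->]]]] xy.
- exact: clusters_inj.
- have e := cluster_stick t01 s01 xy; rewrite e in xy *.
  by apply: sticks_inj xy; rewrite ?lexx ?ler01.
- have e := cluster_stick s01 t01 (esym xy); rewrite e in xy *.
  by apply: sticks_inj xy; rewrite ?lexx ?ler01.
- exact: sticks_inj.
Qed.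

Definition knot_embedding : realization R knot_graph -> 'rV[R]_3 :=
  straight_embedding knot_position.

(** The cluster at corner a lies in the half-open unit cube there, hence in the thick box of the
    stick that starts at a. *)
Lemma knot_embedding_thick v :
  (forall e, e \in knot_edges -> ~ thick e v) -> (~` range knot_embedding) v.
Proof.
move=> nthick [x _ xv].
have edge (a : 'I_20) :
    (knot_vertex a, knot_vertex (next_vertex a)) \in knot_edges.
  by rewrite knot_edgesE; apply: map_f; rewrite mem_iota /=.
have [[a [j [l [t [t01 xE]]]]]|[a [t [t01 xE]]]] := knot_realizationP (set_valP x).
- have vE : v = smap (segpt (a, j) (a, l) t) by rewrite -xv -xE.
  apply: (nthick _ (edge a)) => c; rewrite vE.
  have [-> /andP[y0 y1]] := cluster_coord a j l c t01; rewrite /=.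
  apply/andP; split; first by apply: le_trans (_ : _ <= (coord (knot_vertex a) c)%:R) _;
    rewrite ?ler_nat ?geq_minl// lerDl.
  apply: lt_le_trans (_ : (coord (knot_vertex a) c).+1%:R <= _).
    by rewrite -natr1 ltrD2l.
  by rewrite ler_nat ltnS leq_maxl.
- have vE : v = smap (segpt (a, ord0) (ordS a, ord0) t) by rewrite -xv -xE.
  apply: (nthick _ (edge a)) => c; rewrite vE stick_coord /=; apply/andP; split.
    by apply: convex_ge => //; rewrite ler_nat ?geq_minl ?geq_minr.
  apply: le_lt_trans (_ : _ <= (maxn _ _)%:R) _; last by rewrite ltr_nat.
  by apply: convex_le => //; rewrite ler_nat ?leq_maxl ?leq_maxr.
Qed.

(** Because sticks are parallel to the axes, the closed box spanned by the end points degenerates to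
    the stick; [t] is the affine parameter in its direction. *)
Lemma knot_embedding_edge e (v : 'rV[R]_3) : e \in knot_edges ->
  (forall c : 'I_3, (minn (coord e.1 c) (coord e.2 c))%:R <= v 0 c
    <= (maxn (coord e.1 c) (coord e.2 c))%:R) -> ~ (~` range knot_embedding) v.
Proof.
rewrite knot_edgesE => /mapP[a + ->] /= box; rewrite mem_iota => /= a20; apply.
have [c0 [pq eqc]] := stick_direction a20.
set p := nth 0%N (knot_vertex a) in box pq eqc.
set q := nth 0%N (knot_vertex (next_vertex a)) in box pq eqc.
pose t := (v 0 c0 - (p c0)%:R) / ((q c0)%:R - (p c0)%:R).
have tE : v 0 c0 = (1 - t) * (p c0)%:R + t * (q c0)%:R.
  have npq : (q c0)%:R - (p c0)%:R != 0 :> R by rewrite subr_eq0 eqr_nat eq_sym.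
  have : t * ((q c0)%:R - (p c0)%:R) = v 0 c0 - (p c0)%:R by rewrite divfK.
  lra.
have t01 : 0 <= t <= 1.
  have := box c0; case: (ltngtP (p c0) (q c0)) pq => // lt_pq _.
    move=> /andP[h1 h2].
    have pq : (p c0)%:R < (q c0)%:R :> R by rewrite ltr_nat.
    rewrite /t; apply/andP; split; last by rewrite ler_pdivrMr ?subr_gt0// mul1r lerB.
    by rewrite divr_ge0// subr_ge0// ltW.
  move=> /andP[h1 h2].
  have pq : (q c0)%:R < (p c0)%:R :> R by rewrite ltr_nat.
  rewrite /t -mulrNN -invrN !opprB.
  apply/andP; split; last by rewrite ler_pdivrMr ?subr_gt0// mul1r lerB.
  by rewrite divr_ge0// subr_ge0// ltW.
pose A := Ordinal a20.
have aux : @realization_set R knot_graph (segpt (A, ord0) (ordS A, ord0) t).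
  apply: segpt_realization => //.
  by apply/orP; right; rewrite /= /knot_adj /= !eqxx /= orbT.
exists (SigSub (mem_set aux)) => //.
apply/rowP => c; rewrite [LHS](stick_coord A t c) -/p -/q.
have [->|cc0] := eqVneq c c0; first by rewrite tE.
rewrite -/(p c) -/(q c) (eqc c cc0) -mulrDl subrK mul1r.
have := box c; rewrite (eqc c cc0) minnn maxnn => h.
exact: le_anti h.
Qed.

End Embedding.
End KnotGraph.

Theorem theorem3 (R : realType) (n : nat) (n_ge1 : (1 <= n)%N) :
  exists G : nat -> sgraph,
    (forall i j : nat, i <> j -> ~ graph_iso (G i) (G j)) /\
    (forall i : nat,
      [/\ graph_connected (G i),
          min_valency_is (G i) n &
          exists f : realization R (G i) -> 'rV[R]_3,
            linear_embedding f /\ ~ free_embedding f]).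
Proof.
exists (fun i => knot_graph n i); split.
  move=> i j ij [h h_bij _]; apply: ij.
  have := bij_eq_card h_bij; rewrite !card_knot_graph; lia.
move=> i; split.
- exact: knot_graph_connected.
- exact: knot_graph_min_valency.
- exists (knot_embedding (R := R)); split.
    exact/straight_linear_embedding/knot_position_inj.
  have [x0 nfree] := knot_complement_not_free
    (@knot_embedding_thick n i R) (@knot_embedding_edge n i R).
  by move/(_ x0).
Qed.
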